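(* If $0<M<\sqrt{2}-1$ and $f\in S_M$, then $\mathcal{L}(f)$ is convex, i.e. $\mathcal{L}(f)\in K$. Hence $\mathcal{L}(S_M)\subset K$ for $0<M<\sqrt{2}-1$.
   Context: $\mathbb{D}$ is the open unit disk in $\mathbb{C}$, $\mathcal{H}(\mathbb{D})$ is the class of functions analytic in $\mathbb{D}$, and $\mathcal{H}_0(\mathbb{D})$ is the set of $f\in\mathcal{H}(\mathbb{D})$ with $f(0)=0$ and $f'(0)=1$. For $0<M<1$, $$S_M=\left\{f\in\mathcal{H}_0(\mathbb{D}):\ \left|\frac{zf'(z)}{f(z)}-1\right|<M \text{ for all } z\in\mathbb{D}\right\},$$ where $zf'(z)/f(z)$ is understood to be analytic in $\mathbb{D}$ (with value $1$ at $z=0$; in particular $f\neq 0$ on $\mathbb{D}\setminus\{0\}$). $K$ is the class of (univalent) convex functions: those univalent $f\in\mathcal{H}_0(\mathbb{D})$ with $\operatorname{Re}\left\{1+\frac{zf''(z)}{f'(z)}\right\}>0$ for all $z\in\mathbb{D}$. The Libera transform of $f\in\mathcal{H}_0(\mathbb{D})$ is $\mathcal{L}(f)(z)=\frac{2}{z}\int_0^z f(\zeta)\,d\zeta$, extended analytically to $z=0$ with value $0$. *)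

(* Defs.v *)
From Stdlib Require Import Reals.
From Coquelicot Require Import Coquelicot.

(* Functions on the disk are total functions [C -> C]; no definition below
   depends on their values outside the disk. *)
Definition in_disk (z : C) : Prop := (Cmod z < 1)%R.

(* Analytic means complex differentiable at every point of the disk.  On an
   analytic function [C_derive] is the complex derivative
   ([C_derive_correct]), and [C_derive f] is again analytic on the disk, so
   that [C_derive (C_derive f)] is the second derivative. *)
Definition analytic_in_disk (f : C -> C) : Prop :=
  forall z : C, in_disk z -> @ex_derive C_AbsRing C_NormedModule f z.

Definition normalized_analytic (f : C -> C) : Prop :=
  analytic_in_disk f /\ f (RtoC 0) = RtoC 0 /\ C_derive f (RtoC 0) = RtoC 1.

Definition univalent_in_disk (f : C -> C) : Prop :=
  forall z w : C, in_disk z -> in_disk w -> f z = f w -> z = w.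

(* z f'(z) / f(z), with its removable singularity at 0 filled in for a
   normalized f. *)
Definition starlike_quotient (f : C -> C) (z : C) : C :=
  if Ceq_dec z (RtoC 0) then RtoC 1 else (z * C_derive f z / f z)%C.

Definition class_S (M : R) (f : C -> C) : Prop :=
  normalized_analytic f /\
  (forall z : C, in_disk z -> z <> RtoC 0 -> f z <> RtoC 0) /\
  (forall z : C, in_disk z ->
     (Cmod (starlike_quotient f z - RtoC 1)%C < M)%R).

(* Division in [C] is total, hence the explicit clause f'(z) <> 0, without
   which the quotient z f''(z) / f'(z) has no meaning. *)
Definition class_K (f : C -> C) : Prop :=
  normalized_analytic f /\
  univalent_in_disk f /\
  (forall z : C, in_disk z ->
     C_derive f z <> RtoC 0 /\
     (0 < Re (RtoC 1 + z * C_derive (C_derive f) z / C_derive f z)%C)%R).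

Definition C_RInt (g : R -> C) (a b : R) : C :=
  (RInt (fun t => Re (g t)) a b, RInt (fun t => Im (g t)) a b).

(* The integral from 0 to z is taken along the segment t |-> t z, 0 <= t <= 1;
   for f analytic in the disk it does not depend on the path. *)
Definition integral_from_0 (f : C -> C) (z : C) : C :=
  C_RInt (fun t : R => (f (RtoC t * z) * z)%C) 0 1.

Definition Libera (f : C -> C) (z : C) : C :=
  if Ceq_dec z (RtoC 0) then RtoC 0
  else (RtoC 2 / z * integral_from_0 f z)%C.

(* Main.v *)
Require Import Defs.
From Stdlib Require Import Reals Lra Lia Psatz List.
From Coquelicot Require Import Coquelicot.
Import ListNotations.

(* Put q = z f'/f, u = L(f)/f - 1 and v = f/z - 1, so that |q - 1| < M,
   z u' = (1 - q) - u (1 + q) and z v' = (1 + v)(q - 1). By Jack's lemma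
   Re(z u' conj u) >= |u|^2 at a point where |u| is maximal on a circle, and
   likewise for v, whence |u| <= M/(3-M) and |v| <= M/(1-M). Writing
   F = L(f), we have F' = (1 + v)(1 - u) and 1 + z F''/F' = 2q/(1-u) - 1. The
   latter has positive real part iff |1 - u - q| < |q|, which follows from
   M/(3-M) + M < 1 - M; and |F' - 1| <= (1 + |v|)(1 + |u|) - 1 < 1 makes F
   univalent. Both inequalities hold because M^2 + 2M < 1.

   Jack's lemma needs Schwarz's lemma for functions that are only known to be
   continuous at 0, and F needs a primitive of f; both come from Goursat's
   theorem on rectangles, with finitely many exceptional points. *)

Local Open Scope R_scope.

(** * Complex derivatives and path integrals *)

Notation is_Cderive := (@is_derive C_AbsRing C_NormedModule).
Notation ex_Cderive := (@ex_derive C_AbsRing C_NormedModule).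
Notation is_path_derive := (@is_derive R_AbsRing C_R_NormedModule).
Notation Ccontinuous := (@continuous C_UniformSpace C_UniformSpace).
Notation path_continuous := (@continuous R_UniformSpace C_UniformSpace).
Notation CInt := (@RInt C_R_CompleteNormedModule).
Notation ex_CInt := (@ex_RInt C_R_NormedModule).

(** The values of u and v at 0 are filled in by hand, and only first-order expansions of f and of
    its primitive are available there; differentiability at 0 would need a theorem on removable
    singularities. Exceptional points in Goursat's theorem bypass it, since continuity at finitely
    many points is enough for rectangle integrals to vanish and hence for primitives to exist. The
    same device gives a Cauchy formula: the difference quotient of u at c is exceptional only at 0
    and at c. The integral of dz / (z - c) over the circle is not evaluated. Half of its true
    modulus 2 pi is a sufficient lower bound, and the resulting factor 2 is harmless because
    Schwarz's lemma is reached through n-th powers, where every constant independent of n disappears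
    in the limit. The two final inequalities are one condition: cleared of denominators, both amount
    to 2 M^2 - 8 M + 3 > 0. Its smaller root 2 - sqrt(10)/2, about 0.4189, lies just above sqrt 2 -
    1, about 0.4142. *)

Lemma is_Cderive_eps (f : C -> C) (z l : C) :
  is_Cderive f z l <->
  forall eps : R, 0 < eps -> exists delta : R, 0 < delta /\
    forall w : C, Cmod (w - z) < delta ->
      Cmod (f w - f z - (w - z) * l) <= eps * Cmod (w - z).
Proof.
  split.
  - intros [_ H] eps Heps.
    destruct (H z (fun P HP => HP) (mkposreal eps Heps)) as [d Hd].
    exists d; split; [apply cond_pos|].
    intros w Hw; exact (Hd w Hw).
  - intros H; split.
    + apply is_linear_scal_l.
    + intros x Hx.
      assert (E : z = x).
      { exact (@is_filter_lim_locally_unique C_AbsRing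
                 (AbsRing_NormedModule C_AbsRing) z x Hx). }
      subst x.
      intros eps; destruct (H eps (cond_pos eps)) as [d [Hd Hw]].
      exists (mkposreal d Hd); intros w Hb; exact (Hw w Hb).
Qed.

Lemma is_path_derive_eps (g : R -> C) (t : R) (l : C) :
  is_path_derive g t l <->
  forall eps : R, 0 < eps -> exists delta : R, 0 < delta /\
    forall s : R, Rabs (s - t) < delta ->
      Cmod (g s - g t - RtoC (s - t) * l) <= eps * Rabs (s - t).
Proof.
  assert (E : forall s, minus (minus (g s) (g t)) (scal (minus s t) l)
                 = ((g s - g t - RtoC (s - t) * l)%C : C_R_NormedModule)).
  { intros s. rewrite scal_R_Cmult. reflexivity. }
  split.
  - intros [_ H] eps Heps.
    destruct (H t (fun P HP => HP) (mkposreal eps Heps)) as [d Hd].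
    exists d; split; [apply cond_pos|].
    intros s Hs; rewrite <- E, Cmod_norm; exact (Hd s Hs).
  - intros H; split.
    + apply is_linear_scal_l.
    + intros x Hx.
      assert (Ex : t = x).
      { exact (@is_filter_lim_locally_unique R_AbsRing R_NormedModule t x Hx). }
      subst x.
      intros eps; destruct (H eps (cond_pos eps)) as [d [Hd Hw]].
      exists (mkposreal d Hd); intros s Hb.
      generalize (Hw s Hb); rewrite <- E, Cmod_norm; intros K; exact K.
Qed.

(** Balls of [C_UniformSpace] are squares, from the product structure, so comparison with [Cmod]
    costs a factor sqrt 2, rounded up to 2. In the [C_AbsRing] structure of the next lemma balls are
    already round; derivatives are local in that structure, continuity in this one. *)
Lemma locally_C (z : C) (P : C -> Prop) :
  @locally C_UniformSpace z P <->
  exists delta : R, 0 < delta /\ forall w : C, Cmod (w - z) < delta -> P w.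
Proof.
  split.
  - intros [d Hd]; exists d; split; [apply cond_pos|].
    intros w Hw; apply Hd.
    pose proof (Rmax_Cmod (w - z)%C) as K.
    split; [apply Rle_lt_trans with (2 := Hw); eapply Rle_trans; [apply Rmax_l|exact K]
           |apply Rle_lt_trans with (2 := Hw); eapply Rle_trans; [apply Rmax_r|exact K]].
  - intros [d [Hd H]].
    assert (Hs : 0 < d / 2) by lra.
    exists (mkposreal _ Hs); intros w [H1 H2]; apply H.
    pose proof (Cmod_2Rmax (w - z)%C) as K.
    assert (S : sqrt 2 < 2).
    { rewrite <- (sqrt_square 2) at 2 by lra. apply sqrt_lt_1; lra. }
    assert (M : Rmax (Rabs (fst (w - z)%C)) (Rabs (snd (w - z)%C)) < d / 2).
    { apply Rmax_lub_lt; [exact H1|exact H2]. }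
    assert (0 <= sqrt 2) by apply sqrt_pos.
    assert (0 <= Rmax (Rabs (fst (w - z)%C)) (Rabs (snd (w - z)%C))).
    { eapply Rle_trans; [apply Rabs_pos|apply Rmax_l]. }
    nra.
Qed.

Lemma locally_AbsRing_C (z : C) (P : C -> Prop) :
  @locally (AbsRing_UniformSpace C_AbsRing) z P <->
  exists delta : R, 0 < delta /\ forall w : C, Cmod (w - z) < delta -> P w.
Proof.
  split.
  - intros [d Hd]; exists d; split; [apply cond_pos|].
    intros w Hw; apply Hd; exact Hw.
  - intros [d [Hd H]]; exists (mkposreal d Hd); intros w Hw; apply H; exact Hw.
Qed.

Lemma is_Cderive_ext_loc (f g : C -> C) (z l : C) (r : R) :
  0 < r -> (forall w, Cmod (w - z) < r -> f w = g w) ->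
  is_Cderive f z l -> is_Cderive g z l.
Proof.
  intros Hr H; apply is_derive_ext_loc.
  apply locally_AbsRing_C; exists r; split; auto.
Qed.

Lemma Ccontinuous_eps (f : C -> C) (z : C) :
  Ccontinuous f z <->
  forall eps : R, 0 < eps -> exists delta : R, 0 < delta /\
    forall w : C, Cmod (w - z) < delta -> Cmod (f w - f z) < eps.
Proof.
  split.
  - intros H eps Heps.
    apply (proj1 (locally_C z (fun w => Cmod (f w - f z) < eps))).
    apply (H (fun y => Cmod (y - f z) < eps)).
    apply locally_C; exists eps; auto.
  - intros H P HP.
    apply locally_C in HP; destruct HP as [eps [He HP]].
    destruct (H eps He) as [d [Hd Hw]].
    apply locally_C; exists d; split; auto.
Qed.

Lemma path_continuous_eps (g : R -> C) (t : R) :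
  path_continuous g t <->
  forall eps : R, 0 < eps -> exists delta : R, 0 < delta /\
    forall s : R, Rabs (s - t) < delta -> Cmod (g s - g t) < eps.
Proof.
  split.
  - intros H eps Heps.
    destruct (H (fun y => Cmod (y - g t) < eps)) as [d Hd].
    { apply locally_C; exists eps; auto. }
    exists d; split; [apply cond_pos|]; intros s Hs; apply Hd; exact Hs.
  - intros H P HP.
    apply locally_C in HP; destruct HP as [eps [He HP]].
    destruct (H eps He) as [d [Hd Hw]].
    exists (mkposreal d Hd); intros s Hs; apply HP, Hw; exact Hs.
Qed.

Lemma is_Cderive_continuous (f : C -> C) (z l : C) :
  is_Cderive f z l -> Ccontinuous f z.
Proof.
  intros H; apply Ccontinuous_eps; intros eps He.
  destruct (proj1 (is_Cderive_eps f z l) H 1 Rlt_0_1) as [d [Hd K]].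
  pose proof (Cmod_ge_0 l) as Hl.
  exists (Rmin d (eps / (Cmod l + 1))); split.
  { apply Rmin_glb_lt; [lra|]. apply Rdiv_lt_0_compat; lra. }
  intros w Hw.
  assert (H1 : Cmod (w - z) < d) by (eapply Rlt_le_trans; [exact Hw|apply Rmin_l]).
  assert (H2 : Cmod (w - z) < eps / (Cmod l + 1))
    by (eapply Rlt_le_trans; [exact Hw|apply Rmin_r]).
  specialize (K w H1).
  replace (f w - f z)%C with ((f w - f z - (w - z) * l) + (w - z) * l)%C by ring.
  eapply Rle_lt_trans; [apply Cmod_triangle|]. rewrite Cmod_mult.
  apply Rle_lt_trans with (Cmod (w - z) * (Cmod l + 1)); [nra|].
  apply Rmult_lt_reg_r with (/ (Cmod l + 1)); [apply Rinv_0_lt_compat; lra|].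
  rewrite Rmult_assoc, Rinv_r by lra. unfold Rdiv in H2; lra.
Qed.

(* Coquelicot's product and chain rules see [C] as a module over itself through
   [AbsRing_NormedModule], which is not convertible to [C_NormedModule]. *)
Lemma is_Cderive_AbsRing (f : C -> C) (z l : C) :
  is_Cderive f z l <->
  @is_derive C_AbsRing (AbsRing_NormedModule C_AbsRing) f z l.
Proof.
  split.
  - intros [_ H]; split; [apply is_linear_scal_l|].
    intros x Hx eps; destruct (H x Hx eps) as [d Hd]; exists d.
    intros w Hw; exact (Hd w Hw).
  - intros [_ H]; split; [apply is_linear_scal_l|].
    intros x Hx eps; destruct (H x Hx eps) as [d Hd]; exists d.
    intros w Hw; exact (Hd w Hw).
Qed.

Lemma is_Cderive_const (c z : C) : is_Cderive (fun _ => c) z (RtoC 0).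
Proof. exact (is_derive_const (K := C_AbsRing) (V := C_NormedModule) c z). Qed.

Lemma is_Cderive_id (z : C) : is_Cderive (fun w => w) z (RtoC 1).
Proof. apply is_Cderive_AbsRing, (is_derive_id (K := C_AbsRing)). Qed.

Lemma is_Cderive_plus (f g : C -> C) (z a b : C) :
  is_Cderive f z a -> is_Cderive g z b ->
  is_Cderive (fun w => f w + g w)%C z (a + b)%C.
Proof. exact (is_derive_plus (K := C_AbsRing) (V := C_NormedModule) f g z a b). Qed.

Lemma is_Cderive_minus (f g : C -> C) (z a b : C) :
  is_Cderive f z a -> is_Cderive g z b ->
  is_Cderive (fun w => f w - g w)%C z (a - b)%C.
Proof. exact (is_derive_minus (K := C_AbsRing) (V := C_NormedModule) f g z a b). Qed.

Lemma is_Cderive_mult (f g : C -> C) (z a b : C) :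
  is_Cderive f z a -> is_Cderive g z b ->
  is_Cderive (fun w => f w * g w)%C z (a * g z + f z * b)%C.
Proof.
  intros Hf Hg; apply is_Cderive_AbsRing in Hf, Hg; apply is_Cderive_AbsRing.
  exact (is_derive_mult (K := C_AbsRing) f g z a b Hf Hg Cmult_comm).
Qed.

Lemma is_Cderive_inv (z : C) :
  z <> RtoC 0 -> is_Cderive Cinv z (- / (z * z))%C.
Proof.
  intros Hz; apply is_Cderive_eps; intros eps He.
  assert (Hm : 0 < Cmod z) by (apply Cmod_gt_0; exact Hz).
  (* The error is |w - z|^2 / (|w| |z|^2). The first bound gives |w| > |z| / 2, so the denominator
     exceeds |z|^3 / 2, and the second then leaves at most eps |w - z|. *)
  exists (Rmin (Cmod z / 2) (eps * (Cmod z ^ 3 / 2))); split.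
  { apply Rmin_glb_lt; [lra|]. apply Rmult_lt_0_compat; [lra|].
    pose proof (pow_lt _ 3 Hm); lra. }
  intros w Hw.
  assert (H1 : Cmod (w - z) < Cmod z / 2) by (eapply Rlt_le_trans; [exact Hw|apply Rmin_l]).
  assert (H2 : Cmod (w - z) < eps * (Cmod z ^ 3 / 2))
    by (eapply Rlt_le_trans; [exact Hw|apply Rmin_r]).
  assert (Hwm : Cmod z / 2 < Cmod w).
  { assert (Cmod z <= Cmod w + Cmod (w - z)); [|lra].
    rewrite <- (Cmod_opp (w - z)).
    replace z with (w + - (w - z))%C at 1 by ring. apply Cmod_triangle. }
  assert (Hw0 : w <> RtoC 0) by (apply Cmod_gt_0; lra).
  replace (/ w - / z - (w - z) * - / (z * z))%C
    with ((w - z) * (w - z) / (w * (z * z)))%C by (field; auto).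
  rewrite Cmod_div by (repeat apply Cmult_neq_0; auto).
  rewrite !Cmod_mult.
  pose proof (Cmod_ge_0 (w - z)) as Hp.
  assert (Hd : Cmod z ^ 3 / 2 < Cmod w * (Cmod z * Cmod z)).
  { replace (Cmod z ^ 3 / 2) with (Cmod z / 2 * (Cmod z * Cmod z)) by field.
    apply Rmult_lt_compat_r; [nra|lra]. }
  pose proof (pow_lt _ 3 Hm).
  apply Rmult_le_reg_r with (Cmod w * (Cmod z * Cmod z)); [lra|].
  unfold Rdiv. rewrite Rmult_assoc, Rinv_l, Rmult_1_r by lra.
  assert (Cmod (w - z) <= eps * (Cmod w * (Cmod z * Cmod z))).
  { apply Rle_trans with (eps * (Cmod z ^ 3 / 2)); [lra|].
    apply Rmult_le_compat_l; lra. }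
  nra.
Qed.

Lemma is_Cderive_comp (f g : C -> C) (z a b : C) :
  is_Cderive f (g z) a -> is_Cderive g z b ->
  is_Cderive (fun w => f (g w)) z (b * a)%C.
Proof.
  intros Hf Hg; apply is_Cderive_AbsRing in Hg.
  exact (is_derive_comp (K := C_AbsRing) (V := C_NormedModule) f g z a b Hf Hg).
Qed.

Lemma is_Cderive_div (f g : C -> C) (z a b : C) :
  is_Cderive f z a -> is_Cderive g z b -> g z <> RtoC 0 ->
  is_Cderive (fun w => f w / g w)%C z ((a * g z - f z * b) / (g z * g z))%C.
Proof.
  intros Hf Hg Hn.
  pose proof (is_Cderive_comp Cinv g z _ b (is_Cderive_inv _ Hn) Hg) as Hi.
  pose proof (is_Cderive_mult f _ z _ _ Hf Hi) as Hm.
  replace ((a * g z - f z * b) / (g z * g z))%C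
    with (a * / g z + f z * (b * - / (g z * g z)))%C by (field; auto).
  exact Hm.
Qed.

Lemma is_Cderive_eq (f : C -> C) (z a b : C) :
  is_Cderive f z a -> a = b -> is_Cderive f z b.
Proof. intros H <-; exact H. Qed.

Ltac Cderive :=
  match goal with
  | |- is_derive (fun w => w) _ _ => apply is_Cderive_id
  | |- is_derive (fun _ => ?c) _ _ => apply is_Cderive_const
  | |- is_derive (fun w => Cplus (@?f w) (@?g w)) _ _ =>
      apply (is_Cderive_plus f g); Cderive
  | |- is_derive (fun w => Cminus (@?f w) (@?g w)) _ _ =>
      apply (is_Cderive_minus f g); Cderive
  | |- is_derive (fun w => Cmult (@?f w) (@?g w)) _ _ =>
      apply (is_Cderive_mult f g); Cderive
  | |- is_derive (fun w => Cdiv (@?f w) (@?g w)) _ _ =>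
      apply (is_Cderive_div f g); [Cderive|Cderive|]
  | H : is_derive ?f ?z _ |- is_derive ?f ?z _ => exact H
  | H : is_derive ?f ?z _ |- is_derive (fun w => ?f w) ?z _ => exact H
  | _ => idtac
  end.

Lemma ex_Cderive_pow (f : C -> C) (z : C) (n : nat) :
  ex_Cderive f z -> ex_Cderive (fun w => f w ^ n)%C z.
Proof.
  intros [a Ha]; induction n as [|n [b Hb]]; eexists; simpl.
  - apply is_Cderive_const.
  - exact (is_Cderive_mult f (fun w => f w ^ n)%C z a b Ha Hb).
Qed.

(** The outer derivative is over C and the inner one over R, so no chain rule over a single ring
    applies. The error splits into the error of [K] at [g s] and [l] times the error of [g], each
    allowed half of [eps]. *)
Lemma is_path_derive_comp (K : C -> C) (g : R -> C) (t : R) (l m : C) :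
  is_path_derive g t m -> is_Cderive K (g t) l ->
  is_path_derive (fun s => K (g s)) t (m * l)%C.
Proof.
  intros Hg HK; apply is_path_derive_eps; intros eps He.
  pose proof (Cmod_ge_0 l) as Hl; pose proof (Cmod_ge_0 m) as Hm.
  set (B := Cmod m + 1).
  destruct (proj1 (is_Cderive_eps _ _ _) HK (eps / (2 * B))) as [d1 [Hd1 H1]].
  { apply Rdiv_lt_0_compat; unfold B; lra. }
  (* The bound 1 makes [B] a Lipschitz constant of [g] at [t]; the other bound keeps [e2 * Cmod l]
     below [eps / 2]. *)
  set (e2 := Rmin 1 (eps / (2 * (Cmod l + 1)))).
  assert (He2 : 0 < e2).
  { apply Rmin_glb_lt; [lra|]; apply Rdiv_lt_0_compat; lra. }
  assert (He2a : e2 <= 1) by apply Rmin_l.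
  assert (He2b : e2 * Cmod l <= eps / 2).
  { apply Rle_trans with (eps / (2 * (Cmod l + 1)) * (Cmod l + 1)).
    - apply Rmult_le_compat; try lra. apply Rmin_r.
    - right; field; lra. }
  destruct (proj1 (is_path_derive_eps _ _ _) Hg e2 He2) as [d2 [Hd2 H2]].
  exists (Rmin d2 (d1 / B)); split.
  { apply Rmin_glb_lt; [lra|]; apply Rdiv_lt_0_compat; unfold B; lra. }
  intros s Hs.
  assert (Hs1 : Rabs (s - t) < d2) by (eapply Rlt_le_trans; [exact Hs|apply Rmin_l]).
  assert (Hs2 : Rabs (s - t) < d1 / B) by (eapply Rlt_le_trans; [exact Hs|apply Rmin_r]).
  specialize (H2 s Hs1).
  pose proof (Rabs_pos (s - t)) as Hp.
  assert (Hgs : Cmod (g s - g t) <= B * Rabs (s - t)).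
  { replace (g s - g t)%C with ((g s - g t - RtoC (s - t) * m) + RtoC (s - t) * m)%C by ring.
    eapply Rle_trans; [apply Cmod_triangle|]. rewrite Cmod_mult, Cmod_R. unfold B; nra. }
  assert (HB : 0 < B) by (unfold B; lra).
  assert (Hlt : Cmod (g s - g t) < d1).
  { eapply Rle_lt_trans; [exact Hgs|].
    apply Rmult_lt_compat_l with (r := B) in Hs2; [|exact HB].
    replace (B * (d1 / B)) with d1 in Hs2 by (field; lra). exact Hs2. }
  specialize (H1 (g s) Hlt).
  replace (K (g s) - K (g t) - RtoC (s - t) * (m * l))%C with
    ((K (g s) - K (g t) - (g s - g t) * l) + (g s - g t - RtoC (s - t) * m) * l)%C by ring.
  eapply Rle_trans; [apply Cmod_triangle|]. rewrite Cmod_mult.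
  assert (eps / (2 * B) * Cmod (g s - g t) <= eps / 2 * Rabs (s - t)).
  { apply Rle_trans with (eps / (2 * B) * (B * Rabs (s - t))).
    - apply Rmult_le_compat_l; [|exact Hgs].
      left; apply Rdiv_lt_0_compat; lra.
    - right; field; lra. }
  assert (Cmod (g s - g t - RtoC (s - t) * m) * Cmod l <= eps / 2 * Rabs (s - t)).
  { apply Rle_trans with (e2 * Rabs (s - t) * Cmod l).
    - apply Rmult_le_compat_r; lra.
    - nra. }
  lra.
Qed.

Lemma is_path_derive_line (a v : C) (t : R) :
  is_path_derive (fun s => a + RtoC s * v)%C t v.
Proof.
  apply is_path_derive_eps; intros eps He; exists 1; split; [lra|]; intros s _.
  rewrite RtoC_minus.
  replace (a + s * v - (a + t * v) - (s - t) * v)%C with (RtoC 0) by ring.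
  rewrite Cmod_0; apply Rmult_le_pos; [lra|apply Rabs_pos].
Qed.

Lemma path_continuous_comp (K : C -> C) (g : R -> C) (t : R) :
  path_continuous g t -> Ccontinuous K (g t) -> path_continuous (fun s => K (g s)) t.
Proof. apply (continuous_comp (U := R_UniformSpace) (V := C_UniformSpace) (W := C_UniformSpace)). Qed.

Lemma is_path_derive_continuous (g : R -> C) (t : R) (l : C) :
  is_path_derive g t l -> path_continuous g t.
Proof.
  intros H.
  apply (ex_derive_continuous (K := R_AbsRing) (V := C_R_NormedModule)).
  exists l; exact H.
Qed.

Lemma path_continuous_pair (g : R -> C) (t : R) :
  path_continuous g t <->
  continuous (fun s => Re (g s)) t /\ continuous (fun s => Im (g s)) t.
Proof.
  split.
  - intros H; split.
    + apply (continuous_comp (W := R_UniformSpace) g fst t H). apply continuous_fst.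
    + apply (continuous_comp (W := R_UniformSpace) g snd t H). apply continuous_snd.
  - intros [H1 H2] P HP.
    destruct HP as [e He].
    pose proof (H1 _ (locally_ball _ e)) as K1.
    pose proof (H2 _ (locally_ball _ e)) as K2.
    destruct K1 as [d1 K1], K2 as [d2 K2].
    exists (mkposreal _ (Rmin_stable_in_posreal d1 d2)); intros s Hs; apply He; split.
    + apply K1; eapply Rlt_le_trans; [exact Hs|apply Rmin_l].
    + apply K2; eapply Rlt_le_trans; [exact Hs|apply Rmin_r].
Qed.

Lemma path_continuous_mult (g h : R -> C) (t : R) :
  path_continuous g t -> path_continuous h t ->
  path_continuous (fun s => g s * h s)%C t.
Proof.
  intros Hg Hh; apply path_continuous_pair in Hg; apply path_continuous_pair in Hh.
  destruct Hg as [g1 g2], Hh as [h1 h2].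
  apply path_continuous_pair; split; simpl.
  - apply (continuous_minus (V := R_NormedModule));
      apply (continuous_mult (K := R_AbsRing)); assumption.
  - apply (continuous_plus (V := R_NormedModule));
      apply (continuous_mult (K := R_AbsRing)); assumption.
Qed.

Lemma Ccontinuous_mult (f g : C -> C) (z : C) :
  Ccontinuous f z -> Ccontinuous g z -> Ccontinuous (fun w => f w * g w)%C z.
Proof.
  intros Hf Hg; apply Ccontinuous_eps; intros eps He.
  pose proof (Cmod_ge_0 (f z)) as Pf; pose proof (Cmod_ge_0 (g z)) as Pg.
  set (B := Cmod (f z) + Cmod (g z) + 1).
  assert (HB : 0 < B) by (unfold B; lra).
  set (e := Rmin 1 (eps / (2 * B))).
  assert (H0 : 0 < e).
  { apply Rmin_glb_lt; [lra|]; apply Rdiv_lt_0_compat; lra. }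
  assert (He1 : e <= 1) by apply Rmin_l.
  assert (He2 : e * B <= eps / 2).
  { apply Rle_trans with (eps / (2 * B) * B).
    - apply Rmult_le_compat_r; [lra|apply Rmin_r].
    - right; field; lra. }
  destruct (proj1 (Ccontinuous_eps _ _) Hf e H0) as [d1 [Hd1 K1]].
  destruct (proj1 (Ccontinuous_eps _ _) Hg e H0) as [d2 [Hd2 K2]].
  exists (Rmin d1 d2); split; [apply Rmin_glb_lt; lra|]; intros w Hw.
  assert (Hw1 : Cmod (w - z) < d1) by (eapply Rlt_le_trans; [exact Hw|apply Rmin_l]).
  assert (Hw2 : Cmod (w - z) < d2) by (eapply Rlt_le_trans; [exact Hw|apply Rmin_r]).
  specialize (K1 w Hw1); specialize (K2 w Hw2).
  replace (f w * g w - f z * g z)%C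
    with ((f w - f z) * (g w - g z) + ((f w - f z) * g z + f z * (g w - g z)))%C by ring.
  eapply Rle_lt_trans; [apply Cmod_triangle|].
  eapply Rle_lt_trans; [apply Rplus_le_compat_l, Cmod_triangle|].
  rewrite !Cmod_mult.
  pose proof (Cmod_ge_0 (f w - f z)); pose proof (Cmod_ge_0 (g w - g z)).
  unfold B in He2. nra.
Qed.

Lemma Ccontinuous_plus (f g : C -> C) (z : C) :
  Ccontinuous f z -> Ccontinuous g z -> Ccontinuous (fun w => f w + g w)%C z.
Proof. apply (continuous_plus (V := C_R_NormedModule)). Qed.

Lemma Ccontinuous_minus (f g : C -> C) (z : C) :
  Ccontinuous f z -> Ccontinuous g z -> Ccontinuous (fun w => f w - g w)%C z.
Proof. apply (continuous_minus (V := C_R_NormedModule)). Qed.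

Lemma Ccontinuous_const (c z : C) : Ccontinuous (fun _ => c) z.
Proof. apply continuous_const. Qed.

Lemma Ccontinuous_inv (f : C -> C) (z : C) :
  Ccontinuous f z -> f z <> RtoC 0 -> Ccontinuous (fun w => / f w)%C z.
Proof.
  intros H Hn.
  apply (continuous_comp (U := C_UniformSpace) (V := C_UniformSpace)
           (W := C_UniformSpace) f Cinv); [exact H|].
  exact (is_Cderive_continuous _ _ _ (is_Cderive_inv _ Hn)).
Qed.

(** * Integrals of complex functions of a real variable *)

Lemma ex_CInt_continuous (g : R -> C) (a b : R) :
  (forall t, Rmin a b <= t <= Rmax a b -> path_continuous g t) -> ex_CInt g a b.
Proof. apply (ex_RInt_continuous (V := C_R_CompleteNormedModule)). Qed.

Lemma CInt_correct (g : R -> C) (a b : R) :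
  ex_CInt g a b -> is_RInt (V := C_R_NormedModule) g a b (CInt g a b).
Proof. apply (RInt_correct (V := C_R_CompleteNormedModule)). Qed.

Lemma CInt_unique (g : R -> C) (a b : R) (l : C) :
  is_RInt (V := C_R_NormedModule) g a b l -> CInt g a b = l.
Proof. apply (is_RInt_unique (V := C_R_CompleteNormedModule)). Qed.

Lemma is_RInt_Re (g : R -> C) (a b : R) (l : C) :
  is_RInt (V := C_R_NormedModule) g a b l -> is_RInt (fun t => Re (g t)) a b (Re l).
Proof. apply (is_RInt_fct_extend_fst (U := R_NormedModule) (V := R_NormedModule)). Qed.

Lemma is_RInt_Im (g : R -> C) (a b : R) (l : C) :
  is_RInt (V := C_R_NormedModule) g a b l -> is_RInt (fun t => Im (g t)) a b (Im l).
Proof. apply (is_RInt_fct_extend_snd (U := R_NormedModule) (V := R_NormedModule)). Qed.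

Lemma C_RInt_CInt (g : R -> C) (a b : R) : ex_CInt g a b -> C_RInt g a b = CInt g a b.
Proof.
  intros H; apply CInt_correct in H. unfold C_RInt.
  rewrite (is_RInt_unique _ _ _ _ (is_RInt_Re _ _ _ _ H)).
  rewrite (is_RInt_unique _ _ _ _ (is_RInt_Im _ _ _ _ H)).
  symmetry; apply surjective_pairing.
Qed.

(** The integral is linear over the reals only, so a complex factor has to be carried through real
    and imaginary parts. *)
Lemma is_RInt_Cmult (g : R -> C) (a b : R) (c l : C) :
  is_RInt (V := C_R_NormedModule) g a b l ->
  is_RInt (V := C_R_NormedModule) (fun t => c * g t)%C a b (c * l)%C.
Proof.
  intros H.
  pose proof (is_RInt_Re _ _ _ _ H) as H1; pose proof (is_RInt_Im _ _ _ _ H) as H2.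
  apply (is_RInt_fct_extend_pair (U := R_NormedModule) (V := R_NormedModule)); simpl.
  - apply (is_RInt_minus (V := R_NormedModule));
      apply (is_RInt_scal (V := R_NormedModule)); assumption.
  - apply (is_RInt_plus (V := R_NormedModule)).
    + apply (is_RInt_scal (V := R_NormedModule)); assumption.
    + apply (is_RInt_scal (V := R_NormedModule)); assumption.
Qed.

Lemma CInt_Cmult (g : R -> C) (a b : R) (c : C) :
  ex_CInt g a b -> CInt (fun t => c * g t)%C a b = (c * CInt g a b)%C.
Proof. intros H; apply CInt_unique, is_RInt_Cmult, CInt_correct, H. Qed.

Lemma CInt_Chasles (g : R -> C) (a b c : R) :
  ex_CInt g a b -> ex_CInt g b c -> (CInt g a b + CInt g b c)%C = CInt g a c.
Proof. apply (RInt_Chasles (V := C_R_CompleteNormedModule)). Qed.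

Lemma CInt_derive (G g : R -> C) (a b : R) :
  (forall t, Rmin a b <= t <= Rmax a b -> is_path_derive G t (g t)) ->
  (forall t, Rmin a b <= t <= Rmax a b -> path_continuous g t) ->
  CInt g a b = (G b - G a)%C.
Proof.
  intros H1 H2; apply CInt_unique.
  apply (is_RInt_derive (V := C_R_CompleteNormedModule) G g); assumption.
Qed.

Lemma Cmod_CInt_le (g : R -> C) (a b m : R) :
  ex_CInt g a b ->
  (forall t, Rmin a b <= t <= Rmax a b -> Cmod (g t) <= m) ->
  Cmod (CInt g a b) <= m * Rabs (b - a).
Proof.
  assert (W : forall a b, a <= b -> ex_CInt g a b ->
    (forall t, a <= t <= b -> Cmod (g t) <= m) -> Cmod (CInt g a b) <= m * (b - a)).
  { clear a b; intros a b Hab Hex H.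
    rewrite Cmod_norm.
    apply (norm_RInt_le (V := C_R_NormedModule) g (fun _ => m) a b); auto.
    - intros x Hx; specialize (H x Hx). rewrite Cmod_norm in H; exact H.
    - apply CInt_correct, Hex.
    - rewrite Rmult_comm. apply (is_RInt_const a b m). }
  intros Hex H; destruct (Rle_dec a b) as [Hab|Hab].
  - rewrite Rmin_left, Rmax_right in H by lra. rewrite Rabs_pos_eq by lra. auto.
  - rewrite Rmin_right, Rmax_left in H by lra.
    assert (E : CInt g a b = (- CInt g b a)%C).
    { symmetry. apply (opp_RInt_swap (V := C_R_CompleteNormedModule)), ex_RInt_swap, Hex. }
    rewrite E, Cmod_opp, <- Rabs_Ropp, Rabs_pos_eq by lra.
    replace (- (b - a)) with (a - b) by ring.
    apply W; try lra; auto. apply ex_RInt_swap, Hex.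
Qed.

(** * Goursat's theorem *)

Lemma nested_intervals (a b : nat -> R) :
  (forall n, a n <= a (S n)) -> (forall n, b (S n) <= b n) ->
  (forall n, a n <= b n) ->
  exists p, forall n, a n <= p <= b n.
Proof.
  intros Ha Hb Hab.
  assert (Ma : forall n k, a n <= a (k + n)%nat).
  { intros n k; induction k; simpl; [lra|]. specialize (Ha (k + n)%nat); lra. }
  assert (Mb : forall n k, b (k + n)%nat <= b n).
  { intros n k; induction k; simpl; [lra|]. specialize (Hb (k + n)%nat); lra. }
  assert (Hc : forall n m, a n <= b m).
  { intros n m. pose proof (Ma n m) as K1; pose proof (Mb m n) as K2.
    specialize (Hab (m + n)%nat). replace (n + m)%nat with (m + n)%nat in K2 by lia. lra. }
  destruct (completeness (fun x => exists n, x = a n)) as [p [Hp1 Hp2]].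
  - exists (b O); intros x [n ->]; apply Hc.
  - exists (a O), O; reflexivity.
  - exists p; intros n; split.
    + apply Hp1; exists n; reflexivity.
    + apply Hp2; intros x [m ->]; apply Hc.
Qed.

(** * Bisection of the unit square *)

Section Bisection.

Variable P : R -> R -> R -> Prop.
Variable P_dec : forall s t d, {P s t d} + {~ P s t d}.

Hypothesis P_quarters : forall s t d, 0 < d ->
  0 <= s -> s + (d + d) <= 1 -> 0 <= t -> t + (d + d) <= 1 ->
  P s t d -> P (s + d) t d -> P s (t + d) d -> P (s + d) (t + d) d ->
  P s t (d + d).

Hypothesis P_local : forall p q, 0 <= p <= 1 -> 0 <= q <= 1 ->
  exists eta, 0 < eta /\ forall s t d, 0 < d < eta ->
    0 <= s -> s + d <= 1 -> 0 <= t -> t + d <= 1 ->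
    s <= p <= s + d -> t <= q <= t + d -> P s t d.

(** Lower left corner of a square of side 2^-n on which [P] fails. The last quarter is taken
    untested: if the other three satisfy [P], [P_quarters] makes it the failing one. Decidability of
    [P] turns the choice into a function. *)
Fixpoint bad_corner (n : nat) : R * R :=
  match n with
  | O => (0, 0)
  | S m =>
      let (s, t) := bad_corner m in
      let d := (/ 2) ^ n in
      if P_dec s t d then
        if P_dec (s + d) t d then
          if P_dec s (t + d) d then (s + d, t + d) else (s, t + d)
        else (s + d, t)
      else (s, t)
  end.

(** If [P 0 0 1] failed, some quarter would fail at every stage. The failing squares shrink to a
    point (p, q), and once their side is below the [eta] that [P_local] gives there, failure is
    impossible. *)
Lemma square_bisection : P 0 0 1.
Proof.
  destruct (P_dec 0 0 1) as [H|H0]; [exact H|exfalso].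
  set (s := fun n => fst (bad_corner n)); set (t := fun n => snd (bad_corner n)).
  set (d := fun n => (/ 2) ^ n).
  assert (Hd : forall n, 0 < d n) by (intros n; apply pow_lt; lra).
  assert (Hd2 : forall n, d n = d (S n) + d (S n)) by (intros n; unfold d; simpl; field).
  assert (Hstep : forall n,
    (s (S n) = s n \/ s (S n) = s n + d (S n)) /\
    (t (S n) = t n \/ t (S n) = t n + d (S n)) /\
    (0 <= s n -> s n + d n <= 1 -> 0 <= t n -> t n + d n <= 1 ->
     ~ P (s n) (t n) (d n) -> ~ P (s (S n)) (t (S n)) (d (S n)))).
  { intros n.
    assert (Q : forall a b, 0 <= a -> a + d n <= 1 -> 0 <= b -> b + d n <= 1 ->
      ~ P a b (d n) -> P a b (d (S n)) -> P (a + d (S n)) b (d (S n)) ->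
      P a (b + d (S n)) (d (S n)) -> ~ P (a + d (S n)) (b + d (S n)) (d (S n))).
    { intros a b A1 A2 B1 B2 N K1 K2 K3 K4; apply N; rewrite Hd2.
      apply P_quarters; auto; rewrite <- Hd2; assumption. }
    unfold s, t; simpl bad_corner.
    destruct (bad_corner n) as [a b]; simpl fst; simpl snd.
    change (/ 2 * (/ 2) ^ n) with (d (S n)).
    destruct (P_dec a b (d (S n))); simpl; [|tauto].
    destruct (P_dec (a + d (S n)) b (d (S n))); simpl; [|tauto].
    destruct (P_dec a (b + d (S n)) (d (S n))); simpl; [|tauto].
    repeat split; auto. }
  assert (Hinv : forall n, 0 <= s n /\ s n + d n <= 1 /\ 0 <= t n /\ t n + d n <= 1 /\
                     ~ P (s n) (t n) (d n)).
  { induction n as [|n [I1 [I2 [I3 [I4 I5]]]]].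
    - unfold s, t, d; simpl; repeat split; try lra; exact H0.
    - destruct (Hstep n) as [Es [Et N]].
      specialize (N I1 I2 I3 I4 I5). pose proof (Hd (S n)). rewrite Hd2 in I2, I4.
      destruct Es as [Es|Es], Et as [Et|Et]; rewrite Es, Et in *;
        repeat split; try lra; exact N. }
  destruct (nested_intervals s (fun n => s n + d n)) as [p Hp].
  { intros n; pose proof (Hd (S n)); destruct (Hstep n) as [[E|E] _]; lra. }
  { intros n; pose proof (Hd (S n)); rewrite (Hd2 n); destruct (Hstep n) as [[E|E] _]; lra. }
  { intros n; pose proof (Hd n); lra. }
  destruct (nested_intervals t (fun n => t n + d n)) as [q Hq].
  { intros n; pose proof (Hd (S n)); destruct (Hstep n) as [_ [[E|E] _]]; lra. }
  { intros n; pose proof (Hd (S n)); rewrite (Hd2 n); destruct (Hstep n) as [_ [[E|E] _]]; lra. }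
  { intros n; pose proof (Hd n); lra. }
  destruct (P_local p q) as [eta [He K]].
  { specialize (Hp O); destruct (Hinv O) as [I1 [I2 _]]; lra. }
  { specialize (Hq O); destruct (Hinv O) as [_ [_ [I1 [I2 _]]]]; lra. }
  destruct (pow_lt_1_zero (/ 2)) with (y := eta) as [N HN].
  { rewrite Rabs_pos_eq; lra. }
  { exact He. }
  specialize (HN N (Nat.le_refl N)).
  rewrite Rabs_pos_eq in HN by (left; apply Hd).
  destruct (Hinv N) as [I1 [I2 [I3 [I4 I5]]]].
  apply I5, K; auto.
Qed.

End Bisection.

(** * Integrals along the boundary of a rectangle *)

Definition between (a b x : R) : Prop := Rmin a b <= x <= Rmax a b.

Lemma between_iff (a b x : R) :
  between a b x <-> (a <= x <= b) \/ (b <= x <= a).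
Proof. unfold between, Rmin, Rmax; destruct (Rle_dec a b); lra. Qed.

Lemma between_convex (a b s : R) : 0 <= s <= 1 -> between a b (a + s * (b - a)).
Proof. intros H; apply between_iff; destruct (Rle_dec a b); [left|right]; nra. Qed.

Lemma between_left (a b m x : R) : between a b m -> between a m x -> between a b x.
Proof. rewrite !between_iff; lra. Qed.

Lemma between_right (a b m x : R) : between a b m -> between m b x -> between a b x.
Proof. rewrite !between_iff; lra. Qed.

Lemma between_start (a b : R) : between a b a.
Proof. apply between_iff; lra. Qed.

Lemma between_end (a b : R) : between a b b.
Proof. apply between_iff; lra. Qed.

Lemma between_dist (a b x y : R) :
  between a b x -> between a b y -> Rabs (x - y) <= Rabs (b - a).
Proof.
  rewrite !between_iff; intros; unfold Rabs.
  destruct (Rcase_abs (x - y)), (Rcase_abs (b - a)); lra.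
Qed.

Lemma between_sub (a b s d x : R) :
  0 <= s -> 0 <= d -> s + d <= 1 ->
  between (a + s * (b - a)) (a + (s + d) * (b - a)) x -> between a b x.
Proof.
  intros Hs Hd H; rewrite !between_iff.
  destruct (Rle_dec a b); intros [[]|[]]; [left|left|right|right]; nra.
Qed.

(** The contour integral over the boundary, counterclockwise when a <= b and c <= d. The corners may
    come in any order, with the corresponding sign; this lets an exceptional point always serve as
    the first corner (a, c). *)
Definition rect_integral (f : C -> C) (a b c d : R) : C :=
  (CInt (fun x => f (x, c)) a b - CInt (fun x => f (x, d)) a b
   + Ci * (CInt (fun y => f (b, y)) c d - CInt (fun y => f (a, y)) c d))%C.

Definition continuous_on_rect (f : C -> C) (a b c d : R) : Prop :=
  forall x y, between a b x -> between c d y -> Ccontinuous f (x, y).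

Lemma is_path_derive_horizontal (y t : R) : is_path_derive (fun x => (x, y)) t (RtoC 1).
Proof.
  apply is_path_derive_eps; intros eps He; exists 1; split; [lra|]; intros s _.
  match goal with |- Cmod ?u <= _ => replace u with (RtoC 0) end.
  - rewrite Cmod_0; apply Rmult_le_pos; [lra|apply Rabs_pos].
  - unfold RtoC, Cminus, Cplus, Copp, Cmult; simpl; f_equal; ring.
Qed.

Lemma is_path_derive_vertical (x t : R) : is_path_derive (fun y => (x, y)) t Ci.
Proof.
  apply is_path_derive_eps; intros eps He; exists 1; split; [lra|]; intros s _.
  match goal with |- Cmod ?u <= _ => replace u with (RtoC 0) end.
  - rewrite Cmod_0; apply Rmult_le_pos; [lra|apply Rabs_pos].
  - unfold RtoC, Ci, Cminus, Cplus, Copp, Cmult; simpl; f_equal; ring.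
Qed.

Lemma path_continuous_horizontal (f : C -> C) (x y : R) :
  Ccontinuous f (x, y) -> path_continuous (fun s => f (s, y)) x.
Proof.
  intros H; apply (path_continuous_comp f (fun s => (s, y))); [|exact H].
  eapply is_path_derive_continuous, is_path_derive_horizontal.
Qed.

Lemma path_continuous_vertical (f : C -> C) (x y : R) :
  Ccontinuous f (x, y) -> path_continuous (fun s => f (x, s)) y.
Proof.
  intros H; apply (path_continuous_comp f (fun s => (x, s))); [|exact H].
  eapply is_path_derive_continuous, is_path_derive_vertical.
Qed.

Lemma ex_CInt_horizontal (f : C -> C) (a b y : R) :
  (forall x, between a b x -> Ccontinuous f (x, y)) -> ex_CInt (fun x => f (x, y)) a b.
Proof.
  intros H; apply ex_CInt_continuous; intros x Hx.
  apply path_continuous_horizontal, H, Hx.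
Qed.

Lemma ex_CInt_vertical (f : C -> C) (c d x : R) :
  (forall y, between c d y -> Ccontinuous f (x, y)) -> ex_CInt (fun y => f (x, y)) c d.
Proof.
  intros H; apply ex_CInt_continuous; intros y Hy.
  apply path_continuous_vertical, H, Hy.
Qed.

Lemma CInt_swap (g : R -> C) (a b : R) : ex_CInt g a b -> CInt g b a = (- CInt g a b)%C.
Proof.
  intros H; symmetry.
  apply (opp_RInt_swap (V := C_R_CompleteNormedModule)); exact H.
Qed.

Lemma CInt_point (g : R -> C) (a : R) : CInt g a a = RtoC 0.
Proof. apply (RInt_point (V := C_R_CompleteNormedModule)). Qed.

Lemma rect_integral_split_h (f : C -> C) (a m b c d : R) :
  between a b m -> continuous_on_rect f a b c d ->
  rect_integral f a b c d = (rect_integral f a m c d + rect_integral f m b c d)%C.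
Proof.
  intros Hm H; unfold rect_integral.
  rewrite <- (CInt_Chasles (fun x => f (x, c)) a m b).
  - rewrite <- (CInt_Chasles (fun x => f (x, d)) a m b); [ring| |];
      apply ex_CInt_horizontal; intros x Hx; apply H; try apply between_end.
    + eapply between_left; eauto.
    + eapply between_right; eauto.
  - apply ex_CInt_horizontal; intros x Hx; apply H; try apply between_start.
    eapply between_left; eauto.
  - apply ex_CInt_horizontal; intros x Hx; apply H; try apply between_start.
    eapply between_right; eauto.
Qed.

Lemma rect_integral_split_v (f : C -> C) (a b c n d : R) :
  between c d n -> continuous_on_rect f a b c d ->
  rect_integral f a b c d = (rect_integral f a b c n + rect_integral f a b n d)%C.
Proof.
  intros Hn H; unfold rect_integral.
  rewrite <- (CInt_Chasles (fun y => f (a, y)) c n d).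
  - rewrite <- (CInt_Chasles (fun y => f (b, y)) c n d); [ring| |];
      apply ex_CInt_vertical; intros y Hy; apply H; try apply between_end.
    + eapply between_left; eauto.
    + eapply between_right; eauto.
  - apply ex_CInt_vertical; intros y Hy; apply H; try apply between_start.
    eapply between_left; eauto.
  - apply ex_CInt_vertical; intros y Hy; apply H; try apply between_start.
    eapply between_right; eauto.
Qed.

Lemma rect_integral_split (f : C -> C) (a m b c n d : R) :
  between a b m -> between c d n -> continuous_on_rect f a b c d ->
  rect_integral f a b c d =
    (rect_integral f a m c n + rect_integral f m b c n
     + rect_integral f a m n d + rect_integral f m b n d)%C.
Proof.
  intros Hm Hn H.
  rewrite (rect_integral_split_h f a m b c d), (rect_integral_split_v f a m c n d),
    (rect_integral_split_v f m b c n d); auto.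
  - ring.
  - intros x y Hx Hy; apply H; auto. eapply between_right; eauto.
  - intros x y Hx Hy; apply H; auto. eapply between_left; eauto.
Qed.

Lemma rect_integral_swap_h (f : C -> C) (a b c d : R) :
  continuous_on_rect f a b c d -> rect_integral f b a c d = (- rect_integral f a b c d)%C.
Proof.
  intros H; unfold rect_integral.
  rewrite !(CInt_swap _ a b); [ring| |];
    apply ex_CInt_horizontal; intros x Hx; apply H; auto using between_start, between_end.
Qed.

Lemma rect_integral_swap_v (f : C -> C) (a b c d : R) :
  continuous_on_rect f a b c d -> rect_integral f a b d c = (- rect_integral f a b c d)%C.
Proof.
  intros H; unfold rect_integral.
  rewrite !(CInt_swap _ c d); [ring| |];
    apply ex_CInt_vertical; intros y Hy; apply H; auto using between_start, between_end.
Qed.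

Lemma rect_integral_primitive (K f : C -> C) (a b c d : R) :
  (forall x y, between a b x -> between c d y -> is_Cderive K (x, y) (f (x, y))) ->
  continuous_on_rect f a b c d -> rect_integral f a b c d = RtoC 0.
Proof.
  intros HK H; unfold rect_integral.
  assert (Eh : forall y, between c d y ->
    CInt (fun x => f (x, y)) a b = (K (b, y) - K (a, y))%C).
  { intros y Hy. apply (CInt_derive (fun x => K (x, y))).
    - intros t Ht.
      replace (f (t, y)) with (RtoC 1 * f (t, y))%C by ring.
      apply (is_path_derive_comp K (fun x => (x, y))); [|apply HK; auto].
      apply is_path_derive_horizontal.
    - intros t Ht; apply path_continuous_horizontal, H; auto. }
  assert (Ev : forall x, between a b x ->
    (Ci * CInt (fun y => f (x, y)) c d)%C = (K (x, d) - K (x, c))%C).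
  { intros x Hx.
    rewrite <- CInt_Cmult by (apply ex_CInt_vertical; auto).
    apply (CInt_derive (fun y => K (x, y))).
    - intros t Ht.
      apply (is_path_derive_comp K (fun y => (x, y))); [|apply HK; auto].
      apply is_path_derive_vertical.
    - intros t Ht; apply path_continuous_mult.
      + apply continuous_const.
      + apply path_continuous_vertical, H; auto. }
  replace (Ci * (CInt (fun y => f (b, y)) c d - CInt (fun y => f (a, y)) c d))%C with
    (Ci * CInt (fun y => f (b, y)) c d - Ci * CInt (fun y => f (a, y)) c d)%C by ring.
  rewrite !Eh, !Ev by auto using between_start, between_end. ring.
Qed.

Lemma CInt_minus (f g : R -> C) (a b : R) :
  ex_CInt f a b -> ex_CInt g a b ->
  CInt (fun t => f t - g t)%C a b = (CInt f a b - CInt g a b)%C.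
Proof. apply (RInt_minus (V := C_R_CompleteNormedModule)). Qed.

Lemma rect_integral_minus (f g : C -> C) (a b c d : R) :
  continuous_on_rect f a b c d -> continuous_on_rect g a b c d ->
  rect_integral (fun z => f z - g z)%C a b c d =
  (rect_integral f a b c d - rect_integral g a b c d)%C.
Proof.
  intros Hf Hg; unfold rect_integral.
  assert (Eh : forall y, between c d y -> CInt (fun x => f (x, y) - g (x, y))%C a b =
    (CInt (fun x => f (x, y)) a b - CInt (fun x => g (x, y)) a b)%C).
  { intros y Hy; apply (CInt_minus (fun x => f (x, y)) (fun x => g (x, y)));
      apply ex_CInt_horizontal; auto. }
  assert (Ev : forall x, between a b x -> CInt (fun y => f (x, y) - g (x, y))%C c d =
    (CInt (fun y => f (x, y)) c d - CInt (fun y => g (x, y)) c d)%C).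
  { intros x Hx; apply (CInt_minus (fun y => f (x, y)) (fun y => g (x, y)));
      apply ex_CInt_vertical; auto. }
  rewrite (Eh c), (Eh d), (Ev a), (Ev b) by auto using between_start, between_end.
  ring.
Qed.

Lemma Cmod_rect_integral_le (f : C -> C) (a b c d m : R) :
  continuous_on_rect f a b c d ->
  (forall x y, between a b x -> between c d y -> Cmod (f (x, y)) <= m) ->
  Cmod (rect_integral f a b c d) <= 2 * m * (Rabs (b - a) + Rabs (d - c)).
Proof.
  intros H Hm; unfold rect_integral.
  assert (Hh : forall y, between c d y ->
    Cmod (CInt (fun x => f (x, y)) a b) <= m * Rabs (b - a)).
  { intros y Hy; apply Cmod_CInt_le; [apply ex_CInt_horizontal|]; auto. }
  assert (Hv : forall x, between a b x ->
    Cmod (CInt (fun y => f (x, y)) c d) <= m * Rabs (d - c)).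
  { intros x Hx; apply Cmod_CInt_le; [apply ex_CInt_vertical|]; auto. }
  pose proof (Hh c (between_start _ _)). pose proof (Hh d (between_end _ _)).
  pose proof (Hv a (between_start _ _)). pose proof (Hv b (between_end _ _)).
  eapply Rle_trans; [apply Cmod_triangle|].
  rewrite Cmod_mult, Cmod_Ci, Rmult_1_l.
  eapply Rle_trans; [apply Rplus_le_compat; apply Cmod_triangle|].
  rewrite !Cmod_opp. lra.
Qed.

Lemma Cmod_le_sum (x y : R) : Cmod (x, y) <= Rabs x + Rabs y.
Proof.
  replace (x, y) with (RtoC x + Ci * RtoC y)%C.
  - eapply Rle_trans; [apply Cmod_triangle|].
    rewrite Cmod_mult, Cmod_Ci, !Cmod_R. lra.
  - unfold RtoC, Ci, Cplus, Cmult; simpl; f_equal; ring.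
Qed.

(** The rectangle is parametrized by the unit square, and [P s t e] bounds the integral over a
    subrectangle by eps e^2. Four quarters add up exactly, since 4 eps e^2 = eps (2e)^2. Near a
    point, f differs from an affine function by o(e); the affine function has a primitive, and the
    rest contributes o(e) times a perimeter of order e. *)
Theorem goursat_rectangle (f : C -> C) (a b c d : R) :
  (forall x y, between a b x -> between c d y -> ex_Cderive f (x, y)) ->
  rect_integral f a b c d = RtoC 0.
Proof.
  intros Hf.
  assert (Hc : continuous_on_rect f a b c d).
  { intros x y Hx Hy; destruct (Hf x y Hx Hy) as [l Hl].
    eapply is_Cderive_continuous, Hl. }
  set (X := fun s => a + s * (b - a)); set (Y := fun t => c + t * (d - c)).
  assert (HX : forall s, 0 <= s <= 1 -> between a b (X s)) by (intros; apply between_convex; auto).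
  assert (HY : forall s, 0 <= s <= 1 -> between c d (Y s)) by (intros; apply between_convex; auto).
  apply Cmod_eq_0, Rle_antisym; [|apply Cmod_ge_0].
  apply le_epsilon; intros eps He; rewrite Rplus_0_l.
  set (P := fun s t e => Cmod (rect_integral f (X s) (X (s + e)) (Y t) (Y (t + e)))
                         <= eps * (e * e)).
  enough (HP : P 0 0 1).
  { unfold P, X, Y in HP. rewrite !Rmult_0_l, !Rplus_0_r, !Rplus_0_l, !Rmult_1_l, Rmult_1_r in HP.
    replace (a + (b - a)) with b in HP by ring.
    replace (c + (d - c)) with d in HP by ring. exact HP. }
  assert (Hsub : forall s t e, 0 < e -> 0 <= s -> s + e <= 1 -> 0 <= t -> t + e <= 1 ->
    continuous_on_rect f (X s) (X (s + e)) (Y t) (Y (t + e))).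
  { intros s t e H0 H1 H2 H3 H4 x y Hx Hy; apply Hc.
    - apply (between_sub a b s e); auto; lra.
    - apply (between_sub c d t e); auto; lra. }
  apply square_bisection.
  - intros; apply Rle_dec.
  - intros s t e H0 H1 H2 H3 H4 P1 P2 P3 P4; unfold P in *.
    rewrite (rect_integral_split f _ (X (s + e)) _ _ (Y (t + e)));
      [| | |apply Hsub; lra].
    + replace (s + (e + e)) with (s + e + e) by ring.
      replace (t + (e + e)) with (t + e + e) by ring.
      eapply Rle_trans; [apply Cmod_triangle|].
      eapply Rle_trans; [apply Rplus_le_compat_r, Cmod_triangle|].
      eapply Rle_trans; [apply Rplus_le_compat_r, Rplus_le_compat_r, Cmod_triangle|].
      lra.
    + unfold X; apply between_iff; destruct (Rle_dec a b); [left|right]; nra.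
    + unfold Y; apply between_iff; destruct (Rle_dec c d); [left|right]; nra.
  - intros p q Hp Hq.
    destruct (Hf (X p) (Y q) (HX p Hp) (HY q Hq)) as [l Hl].
    set (z0 := (X p, Y q)) in *.
    set (L := Rabs (b - a) + Rabs (d - c)).
    assert (HL : 0 <= L) by (unfold L; pose proof (Rabs_pos (b - a)); pose proof (Rabs_pos (d - c)); lra).
    assert (HQ : 0 < 2 * (L * L) + 1) by nra.
    (* With this tolerance the integrand is at most eps e L / (2 L^2 + 1) on a boundary of length 2
       e L, giving less than eps e^2. Adding 1 here, and to [L] in the radius below, covers the
       degenerate case L = 0. *)
    destruct (proj1 (is_Cderive_eps _ _ _) Hl (eps / (2 * (L * L) + 1))) as [r [Hr K]].
    { apply Rdiv_lt_0_compat; lra. }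
    exists (r / (L + 1)); split; [apply Rdiv_lt_0_compat; lra|].
    intros s t e [He1 He2] H1 H2 H3 H4 Hsp Htq; unfold P.
    set (A := fun z : C => (f z0 + (z - z0) * l)%C).
    assert (HA : forall z, is_Cderive A z l).
    { intros z; unfold A; eapply is_Cderive_eq; [Cderive|ring]. }
    assert (HcA : forall a b c d, continuous_on_rect A a b c d).
    { intros ? ? ? ? x y _ _; eapply is_Cderive_continuous, HA. }
    assert (EA : rect_integral A (X s) (X (s + e)) (Y t) (Y (t + e)) = RtoC 0).
    { apply (rect_integral_primitive (fun z => f z0 * z + (/ 2) * ((z - z0) * (z - z0)) * l)%C);
        [|apply HcA].
      intros x y _ _; unfold A; set (z := (x, y)).
      eapply is_Cderive_eq; [Cderive|]. field; intros E; injection E; lra. }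
    replace (rect_integral f (X s) (X (s + e)) (Y t) (Y (t + e))) with
      (rect_integral (fun z => f z - A z)%C (X s) (X (s + e)) (Y t) (Y (t + e)));
      [|rewrite rect_integral_minus, EA; [ring|apply Hsub; lra|apply HcA]].
    assert (DX : X (s + e) - X s = e * (b - a)) by (unfold X; ring).
    assert (DY : Y (t + e) - Y t = e * (d - c)) by (unfold Y; ring).
    assert (Bp : between (X s) (X (s + e)) (X p)).
    { unfold X; apply between_iff; destruct (Rle_dec a b); [left|right]; nra. }
    assert (Bq : between (Y t) (Y (t + e)) (Y q)).
    { unfold Y; apply between_iff; destruct (Rle_dec c d); [left|right]; nra. }
    eapply Rle_trans; [apply Cmod_rect_integral_le with
      (m := eps / (2 * (L * L) + 1) * (e * L))|].
    + intros x y Hx Hy; apply Ccontinuous_minus.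
      * apply (Hsub s t e); auto.
      * eapply is_Cderive_continuous, HA.
    + intros x y Hx Hy.
      assert (Hz : Cmod ((x, y) - z0) <= e * L).
      { unfold z0. replace ((x, y) - (X p, Y q))%C with (x - X p, y - Y q)
          by (unfold Cminus, Cplus, Copp; simpl; f_equal; ring).
        eapply Rle_trans; [apply Cmod_le_sum|].
        pose proof (between_dist _ _ _ _ Hx Bp) as K1.
        pose proof (between_dist _ _ _ _ Hy Bq) as K2.
        rewrite DX, Rabs_mult, (Rabs_pos_eq e) in K1 by lra.
        rewrite DY, Rabs_mult, (Rabs_pos_eq e) in K2 by lra.
        unfold L; lra. }
      unfold A.
      replace (f (x, y) - (f z0 + ((x, y) - z0) * l))%C with
        (f (x, y) - f z0 - ((x, y) - z0) * l)%C by ring.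
      eapply Rle_trans; [apply K|].
      * apply Rle_lt_trans with (1 := Hz).
        apply Rle_lt_trans with (e * (L + 1)); [nra|].
        apply Rlt_le_trans with (r / (L + 1) * (L + 1)).
        { apply Rmult_lt_compat_r; lra. }
        right; field; lra.
      * apply Rmult_le_compat_l; [|exact Hz].
        left; apply Rdiv_lt_0_compat; lra.
    + rewrite DX, DY, !Rabs_mult, (Rabs_pos_eq e) by lra.
      replace (e * Rabs (b - a) + e * Rabs (d - c)) with (e * L) by (unfold L; ring).
      replace (2 * (eps / (2 * (L * L) + 1) * (e * L)) * (e * L)) with
        (eps * (e * e) * (2 * (L * L) / (2 * (L * L) + 1))) by (field; lra).
      rewrite <- (Rmult_1_r (eps * (e * e))) at 2.
      apply Rmult_le_compat_l; [nra|].
      apply Rmult_le_reg_r with (2 * (L * L) + 1); [lra|].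
      unfold Rdiv; rewrite Rmult_assoc, Rinv_l by lra. lra.
Qed.

Lemma rect_integral_degenerate (f : C -> C) (a b c d : R) :
  a = b \/ c = d -> rect_integral f a b c d = RtoC 0.
Proof.
  unfold rect_integral; intros [<-| <-]; rewrite !CInt_point; ring.
Qed.

(* At an exceptional corner only continuity is known: cutting off an
   arbitrarily small rectangle there leaves three rectangles avoiding it. *)
Lemma rect_integral_exceptional_corner (f : C -> C) (px py b d : R) :
  continuous_on_rect f px b py d ->
  (forall a' b' c' d',
     (forall x y, between a' b' x -> between c' d' y ->
        between px b x /\ between py d y /\ (x, y) <> (px, py)) ->
     rect_integral f a' b' c' d' = RtoC 0) ->
  rect_integral f px b py d = RtoC 0.
Proof.
  intros Hc H.
  destruct (Req_dec px b) as [E|Nb]; [apply rect_integral_degenerate; auto|].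
  destruct (Req_dec py d) as [E|Nd]; [apply rect_integral_degenerate; auto|].
  apply Cmod_eq_0, Rle_antisym; [|apply Cmod_ge_0].
  apply le_epsilon; intros eps He; rewrite Rplus_0_l.
  destruct (proj1 (Ccontinuous_eps _ _)
             (Hc px py (between_start _ _) (between_start _ _)) 1 Rlt_0_1) as [r [Hr K]].
  set (L := Rabs (b - px) + Rabs (d - py)).
  assert (HL : 0 < L).
  { unfold L; pose proof (Rabs_pos (d - py)).
    assert (0 < Rabs (b - px)) by (apply Rabs_pos_lt; lra). lra. }
  set (m := Cmod (f (px, py)) + 1).
  assert (Hm : 0 < m) by (unfold m; pose proof (Cmod_ge_0 (f (px, py))); lra).
  (* The first bound places the cut inside the rectangle, the second keeps the corner piece within
     distance [r], where |f| <= m, and the third makes its boundary estimate 2 m e L at most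
     [eps]. *)
  set (e := Rmin (/ 2) (Rmin (r / (2 * L)) (eps / (2 * m * L)))).
  assert (He0 : 0 < e).
  { unfold e; repeat apply Rmin_glb_lt; [lra| |]; apply Rdiv_lt_0_compat; nra. }
  assert (He1 : e <= / 2) by apply Rmin_l.
  assert (He2 : e <= r / (2 * L)) by (eapply Rle_trans; [apply Rmin_r|apply Rmin_l]).
  assert (He3 : e <= eps / (2 * m * L)) by (eapply Rle_trans; [apply Rmin_r|apply Rmin_r]).
  set (x1 := px + e * (b - px)); set (y1 := py + e * (d - py)).
  assert (Bx : between px b x1) by (apply between_convex; lra).
  assert (By : between py d y1) by (apply between_convex; lra).
  assert (Sx : forall x, between x1 b x -> x <> px).
  { intros x; unfold x1; rewrite between_iff; intros Hx ->.
    destruct (Rtotal_order px b) as [T|[T|T]]; [|contradiction|]; nra. }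
  assert (Sy : forall y, between y1 d y -> y <> py).
  { intros y; unfold y1; rewrite between_iff; intros Hy ->.
    destruct (Rtotal_order py d) as [T|[T|T]]; [|contradiction|]; nra. }
  rewrite (rect_integral_split f px x1 b py y1 d Bx By Hc).
  rewrite (H x1 b py y1), (H px x1 y1 d), (H x1 b y1 d).
  - rewrite !Cplus_0_r.
    assert (DX : x1 - px = e * (b - px)) by (unfold x1; ring).
    assert (DY : y1 - py = e * (d - py)) by (unfold y1; ring).
    eapply Rle_trans; [apply Cmod_rect_integral_le with (m := m)|].
    + intros x y Hx Hy; apply Hc; eapply between_left; eauto.
    + intros x y Hx Hy.
      assert (Hd : Cmod ((x, y) - (px, py)) < r).
      { replace ((x, y) - (px, py))%C with (x - px, y - py)
          by (unfold Cminus, Cplus, Copp; simpl; f_equal; ring).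
        eapply Rle_lt_trans; [apply Cmod_le_sum|].
        pose proof (between_dist _ _ _ _ Hx (between_start _ _)) as K1.
        pose proof (between_dist _ _ _ _ Hy (between_start _ _)) as K2.
        rewrite DX, Rabs_mult, (Rabs_pos_eq e) in K1 by lra.
        rewrite DY, Rabs_mult, (Rabs_pos_eq e) in K2 by lra.
        apply Rle_lt_trans with (e * L); [unfold L; lra|].
        apply Rle_lt_trans with (r / (2 * L) * L); [apply Rmult_le_compat_r; lra|].
        replace (r / (2 * L) * L) with (r / 2) by (field; lra). lra. }
      specialize (K _ Hd). unfold m.
      replace (f (x, y)) with ((f (x, y) - f (px, py)) + f (px, py))%C by ring.
      eapply Rle_trans; [apply Cmod_triangle|]. lra.
    + rewrite DX, DY, !Rabs_mult, (Rabs_pos_eq e) by lra.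
      replace (e * Rabs (b - px) + e * Rabs (d - py)) with (e * L) by (unfold L; ring).
      apply Rle_trans with (2 * m * (eps / (2 * m * L) * L)).
      * apply Rmult_le_compat_l; [lra|]. apply Rmult_le_compat_r; lra.
      * right; field; lra.
  - intros x y Hx Hy; split; [eapply between_right; eauto|].
    split; [eapply between_right; eauto|]. intros E; injection E; intros _ E'; exact (Sx x Hx E').
  - intros x y Hx Hy; split; [eapply between_left; eauto|].
    split; [eapply between_right; eauto|]. intros E; injection E; intros E' _; exact (Sy y Hy E').
  - intros x y Hx Hy; split; [eapply between_right; eauto|].
    split; [eapply between_left; eauto|]. intros E; injection E; intros _ E'; exact (Sx x Hx E').
Qed.

(** Induction on the list. A rectangle avoiding the first point falls under the induction
    hypothesis; otherwise it is cut at that point into four rectangles having it as a corner, which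
    [rect_integral_exceptional_corner] treats once they are reoriented to start there. *)
Theorem goursat_exceptional (f : C -> C) (l : list C) :
  forall a b c d : R, continuous_on_rect f a b c d ->
  (forall x y, between a b x -> between c d y -> ~ In (x, y) l -> ex_Cderive f (x, y)) ->
  rect_integral f a b c d = RtoC 0.
Proof.
  induction l as [|[px py] l IH]; intros a b c d Hc Hf.
  { apply goursat_rectangle; intros x y Hx Hy; apply Hf; auto. }
  assert (Hno : forall a' b' c' d',
    (forall x y, between a' b' x -> between c' d' y ->
        between a b x /\ between c d y /\ (x, y) <> (px, py)) ->
    rect_integral f a' b' c' d' = RtoC 0).
  { intros a' b' c' d' H; apply IH.
    - intros x y Hx Hy; destruct (H x y Hx Hy) as [H1 [H2 _]]; auto.
    - intros x y Hx Hy Hn; destruct (H x y Hx Hy) as [H1 [H2 H3]].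
      apply Hf; auto. intros [E|E]; [apply H3; auto|contradiction]. }
  assert (Hdec : (between a b px /\ between c d py) \/ ~ (between a b px /\ between c d py)).
  { unfold between; destruct (Rle_dec (Rmin a b) px), (Rle_dec px (Rmax a b)),
      (Rle_dec (Rmin c d) py), (Rle_dec py (Rmax c d)); tauto. }
  destruct Hdec as [[Bx By]|Hout].
  2:{ apply Hno; intros x y Hx Hy; repeat split; auto; try apply Hx; try apply Hy.
      intros E; injection E; intros -> ->; tauto. }
  assert (Hcorner : forall x y, x = a \/ x = b -> y = c \/ y = d ->
    continuous_on_rect f px x py y /\ rect_integral f px x py y = RtoC 0).
  { intros x y Hx Hy.
    assert (Ix : forall s, between px x s -> between a b s).
    { intros s; revert Bx; rewrite !between_iff; destruct Hx as [-> | ->]; lra. }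
    assert (Iy : forall s, between py y s -> between c d s).
    { intros s; revert By; rewrite !between_iff; destruct Hy as [-> | ->]; lra. }
    assert (Hcc : continuous_on_rect f px x py y).
    { intros s t Hs Ht; apply Hc; auto. }
    split; [exact Hcc|].
    apply rect_integral_exceptional_corner; [exact Hcc|].
    intros a' b' c' d' H; apply Hno; intros s t Hs Ht.
    destruct (H s t Hs Ht) as [K1 [K2 K3]]; auto. }
  rewrite (rect_integral_split f a px b c py d Bx By Hc).
  destruct (Hcorner a c) as [C1 E1]; auto.
  destruct (Hcorner b c) as [C2 E2]; auto.
  destruct (Hcorner a d) as [C3 E3]; auto.
  destruct (Hcorner b d) as [C4 E4]; auto.
  rewrite E4.
  rewrite (rect_integral_swap_v f px b py c C2), E2.
  rewrite (rect_integral_swap_h f px a py d C3), E3.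
  rewrite (rect_integral_swap_h f px a c py).
  - rewrite (rect_integral_swap_v f px a py c C1), E1. ring.
  - intros x y Hx Hy; apply C1; auto. revert Hy; rewrite !between_iff; lra.
Qed.

(** * Primitives, Schwarz's lemma and Jack's lemma *)

Lemma in_disk_iff (x y : R) : in_disk (x, y) <-> x * x + y * y < 1.
Proof.
  unfold in_disk, Cmod; simpl. rewrite !Rmult_1_r.
  split; intros H.
  - apply Rnot_le_lt; intros K; apply (Rlt_not_le _ _ H).
    rewrite <- sqrt_1; apply sqrt_le_1_alt; exact K.
  - rewrite <- sqrt_1; apply sqrt_lt_1_alt; nra.
Qed.

Lemma CInt_const (c : C) (a b : R) : CInt (fun _ => c) a b = (RtoC (b - a) * c)%C.
Proof.
  transitivity (scal (b - a) (c : C_R_NormedModule)).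
  - apply (RInt_const (V := C_R_CompleteNormedModule)).
  - apply scal_R_Cmult.
Qed.

Lemma Cmod_CInt_minus_const_le (g : R -> C) (c : C) (a b m : R) :
  ex_CInt g a b -> (forall t, between a b t -> Cmod (g t - c) <= m) ->
  Cmod (CInt g a b - RtoC (b - a) * c) <= m * Rabs (b - a).
Proof.
  intros Hg H. rewrite <- CInt_const.
  assert (Hc : ex_CInt (fun _ => c) a b) by apply ex_RInt_const.
  rewrite <- CInt_minus by assumption.
  apply Cmod_CInt_le; [|exact H].
  exact (ex_RInt_minus (V := C_R_NormedModule) g (fun _ => c) a b Hg Hc).
Qed.

Lemma Cmod_Re_Im (z : C) : Rabs (Re z) <= Cmod z /\ Rabs (Im z) <= Cmod z.
Proof.
  pose proof (Rmax_Cmod z) as K; split; (eapply Rle_trans; [|exact K]).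
  - apply Rmax_l.
  - apply Rmax_r.
Qed.

(** The primitive integrates from 0 along the real axis to x, then vertically to (x, y). Goursat on
    the rectangle between x and u, 0 and y lifts the horizontal increment from the axis to height y.
    So the increment of the primitive from (x, y) to (u, v) is an integral along the two short sides
    through (u, y), where f is close to f(x, y). *)
Theorem primitive_in_disk (f : C -> C) (l : list C) :
  (forall z, in_disk z -> Ccontinuous f z) ->
  (forall z, in_disk z -> ~ In z l -> ex_Cderive f z) ->
  exists K : C -> C, forall z, in_disk z -> is_Cderive K z (f z).
Proof.
  intros Hc Hf.
  exists (fun z => CInt (fun s => f (s, 0)) 0 (fst z)
                   + Ci * CInt (fun t => f (fst z, t)) 0 (snd z))%C.
  intros [x y] Hz.
  assert (Hh : forall a b y, (forall x, between a b x -> in_disk (x, y)) ->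
    ex_CInt (fun s => f (s, y)) a b).
  { intros a b y0 H; apply ex_CInt_horizontal; intros; apply Hc, H; auto. }
  assert (Hv : forall c d x, (forall y, between c d y -> in_disk (x, y)) ->
    ex_CInt (fun s => f (x, s)) c d).
  { intros c d x0 H; apply ex_CInt_vertical; intros; apply Hc, H; auto. }
  apply is_Cderive_eps; intros eps He.
  (* Half of [eps], because the two sides through (u, y) have total length at most twice the
     distance from (x, y) to (u, v). *)
  destruct (proj1 (Ccontinuous_eps _ _) (Hc _ Hz) (eps / 2)) as [r [Hr K]]; [lra|].
  exists (Rmin (r / 2) (1 - Cmod (x, y))); split.
  { apply Rmin_glb_lt; [lra|]; unfold in_disk in Hz; lra. }
  intros [u v] Hw; simpl fst; simpl snd.
  assert (Hw1 : Cmod ((u, v) - (x, y)) < r / 2) by (eapply Rlt_le_trans; [exact Hw|apply Rmin_l]).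
  assert (Hw2 : Cmod ((u, v) - (x, y)) < 1 - Cmod (x, y))
    by (eapply Rlt_le_trans; [exact Hw|apply Rmin_r]).
  destruct (Cmod_Re_Im ((u, v) - (x, y))%C) as [Hu Hv'].
  simpl in Hu, Hv'.
  change (Rabs (u - x) <= Cmod ((u, v) - (x, y))%C) in Hu.
  change (Rabs (v - y) <= Cmod ((u, v) - (x, y))%C) in Hv'.
  assert (Hnear : forall s t, Cmod ((s, t) - (x, y)) < 1 - Cmod (x, y) -> in_disk (s, t)).
  { intros s t H; unfold in_disk.
    replace (Cmod (s, t)) with (Cmod (((s, t) - (x, y)) + (x, y))).
    - eapply Rle_lt_trans; [apply Cmod_triangle|lra].
    - f_equal; ring. }
  assert (Hsub : forall s t, Rabs (s - x) <= Rabs (u - x) -> Rabs (t - y) <= Rabs (v - y) ->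
     Cmod ((s, t) - (x, y)) <= Cmod ((u, v) - (x, y))).
  { intros s t H1 H2; unfold Cmod; apply sqrt_le_1_alt; simpl.
    apply Rsqr_le_abs_1 in H1; apply Rsqr_le_abs_1 in H2; unfold Rsqr in H1, H2. nra. }
  assert (Duv : in_disk (u, v)) by (apply Hnear; exact Hw2).
  assert (Duy : in_disk (u, y)).
  { apply Hnear; eapply Rle_lt_trans; [apply Hsub|exact Hw2]; [lra|].
    rewrite Rminus_diag, Rabs_R0; apply Rabs_pos. }
  apply in_disk_iff in Duv; apply in_disk_iff in Duy; apply in_disk_iff in Hz.
  (* A square s * s on an interval is largest at an endpoint, so no point of the rectangle is
     farther from 0 than the farther of (x, y) and (u, y). *)
  assert (Drect : forall s t, between x u s -> between 0 y t -> in_disk (s, t)).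
  { intros s t; rewrite !between_iff, in_disk_iff; intros [Hs|Hs] [Ht|Ht];
      (assert (s * s <= x * x \/ s * s <= u * u);
       [destruct (Rle_dec 0 s); [destruct (Rle_dec x u)|destruct (Rle_dec x u)];
        solve [left; nra|right; nra]|]);
      (assert (t * t <= y * y); [nra|]); lra. }
  assert (Dside : forall t, between y v t -> in_disk (u, t)).
  { intros t; rewrite !between_iff, in_disk_iff; intros [Ht|Ht];
      (assert (t * t <= y * y \/ t * t <= v * v);
       [destruct (Rle_dec 0 t); solve [left; nra|right; nra]|]); lra. }
  assert (E : rect_integral f x u 0 y = RtoC 0).
  { apply (goursat_exceptional f l).
    - intros s t Hs Ht; apply Hc; auto.
    - intros s t Hs Ht Hn; apply Hf; auto. }
  unfold rect_integral in E.
  assert (E1 : (CInt (fun s => f (s, 0)) 0 x + CInt (fun s => f (s, 0)) x u)%C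
               = CInt (fun s => f (s, 0)) 0 u).
  { apply CInt_Chasles; apply Hh; intros s.
    - rewrite between_iff, in_disk_iff; intros [Hs|Hs]; nra.
    - intros Hs; apply Drect; auto using between_start. }
  assert (E2 : (CInt (fun t => f (u, t)) 0 y + CInt (fun t => f (u, t)) y v)%C
               = CInt (fun t => f (u, t)) 0 v).
  { apply CInt_Chasles; apply Hv; intros t.
    - intros Ht; apply Drect; auto using between_end.
    - auto. }
  rewrite <- E1, <- E2.
  match goal with |- Cmod ?X <= _ =>
    replace X with
      ((CInt (fun s => f (s, y)) x u - RtoC (u - x) * f (x, y))
       + Ci * (CInt (fun t => f (u, t)) y v - RtoC (v - y) * f (x, y)))%C end.
  2:{ assert (Ew : ((u, v) - (x, y))%C = (RtoC (u - x) + Ci * RtoC (v - y))%C).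
      { unfold RtoC, Ci, Cminus, Cplus, Copp, Cmult; simpl; f_equal; ring. }
      rewrite Ew.
      match type of E with ?A = _ =>
        match goal with |- ?L = ?R => assert (EE : (R - L)%C = A) by ring end end.
      rewrite E in EE. symmetry; apply Ceq_minus; exact EE. }
  assert (B1 : Cmod (CInt (fun s => f (s, y)) x u - RtoC (u - x) * f (x, y))
               <= eps / 2 * Rabs (u - x)).
  { apply Cmod_CInt_minus_const_le.
    - apply Hh; intros s Hs; apply Drect; auto using between_end.
    - intros s Hs; left; apply K.
      eapply Rle_lt_trans; [apply Hsub|lra].
      + apply between_dist; auto using between_start.
      + rewrite Rminus_diag, Rabs_R0; apply Rabs_pos. }
  assert (B2 : Cmod (CInt (fun t => f (u, t)) y v - RtoC (v - y) * f (x, y))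
               <= eps / 2 * Rabs (v - y)).
  { apply Cmod_CInt_minus_const_le.
    - apply Hv; auto.
    - intros t Ht; left; apply K.
      eapply Rle_lt_trans; [apply Hsub|lra].
      + lra.
      + apply between_dist; auto using between_start. }
  eapply Rle_trans; [apply Cmod_triangle|].
  rewrite Cmod_mult, Cmod_Ci, Rmult_1_l. nra.
Qed.

(** * Circles and Cauchy's formula for functions continuous at 0 *)

Definition circle (r t : R) : C := (r * cos t, r * sin t).

Lemma Cmod_circle (r t : R) : 0 <= r -> Cmod (circle r t) = r.
Proof.
  intros Hr; unfold circle, Cmod; simpl.
  replace (r * cos t * (r * cos t * 1) + r * sin t * (r * sin t * 1))
    with (r * r * (Rsqr (sin t) + Rsqr (cos t))) by (unfold Rsqr; ring).
  rewrite sin2_cos2, Rmult_1_r. apply sqrt_square, Hr.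
Qed.

Lemma is_path_derive_circle (r t : R) : is_path_derive (circle r) t (Ci * circle r t)%C.
Proof.
  assert (Hd : is_derive (fun s => r * cos s) t (r * - sin t)).
  { auto_derive; auto; ring. }
  assert (Hs : is_derive (fun s => r * sin s) t (r * cos t)).
  { auto_derive; auto; ring. }
  assert (E : (Ci * circle r t)%C = (r * - sin t, r * cos t)).
  { unfold circle, Ci, Cmult; simpl; f_equal; ring. }
  rewrite E; apply is_path_derive_eps; intros eps He.
  destruct Hd as [_ Hd]; destruct Hs as [_ Hs].
  assert (Hp : 0 < eps / 2) by lra.
  destruct (Hd t (fun P HP => HP) (mkposreal _ Hp)) as [d1 H1].
  destruct (Hs t (fun P HP => HP) (mkposreal _ Hp)) as [d2 H2].
  exists (Rmin d1 d2); split; [apply Rmin_glb_lt; apply cond_pos|].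
  intros s Hst.
  specialize (H1 s (Rlt_le_trans _ _ _ Hst (Rmin_l _ _))).
  specialize (H2 s (Rlt_le_trans _ _ _ Hst (Rmin_r _ _))).
  change (Rabs (r * cos s - r * cos t - (s - t) * (r * - sin t)) <= eps / 2 * Rabs (s - t)) in H1.
  change (Rabs (r * sin s - r * sin t - (s - t) * (r * cos t)) <= eps / 2 * Rabs (s - t)) in H2.
  match goal with |- Cmod ?X <= _ => replace X with
    (r * cos s - r * cos t - (s - t) * (r * - sin t),
     r * sin s - r * sin t - (s - t) * (r * cos t)) end.
  - eapply Rle_trans; [apply Cmod_le_sum|]. lra.
  - unfold circle, RtoC, Cminus, Cplus, Copp, Cmult; simpl; f_equal; ring.
Qed.

Lemma path_continuous_circle (r t : R) : path_continuous (circle r) t.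
Proof. eapply is_path_derive_continuous, is_path_derive_circle. Qed.

Lemma circle_surjective (z : C) : z <> RtoC 0 ->
  exists t, 0 <= t <= 2 * PI /\ z = circle (Cmod z) t.
Proof.
  intros Hz; apply Cmod_gt_0 in Hz.
  destruct z as [x y]; set (r := Cmod (x, y)) in *.
  assert (Hr : r * r = x * x + y * y).
  { unfold r, Cmod; simpl; rewrite sqrt_sqrt by nra; ring. }
  assert (Hx : -1 <= x / r <= 1).
  { split; apply Rmult_le_reg_r with r; auto; unfold Rdiv;
      rewrite Rmult_assoc, Rinv_l by lra; nra. }
  assert (Hc : r * cos (acos (x / r)) = x).
  { rewrite cos_acos by exact Hx; field; lra. }
  assert (Hs : r * sin (acos (x / r)) = Rabs y).
  { rewrite sin_acos by exact Hx.
    rewrite <- (Rabs_pos_eq r) at 1 by lra. rewrite <- sqrt_Rsqr_abs, <- sqrt_mult_alt by apply Rle_0_sqr.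
    rewrite <- sqrt_Rsqr_abs; f_equal; unfold Rsqr.
    transitivity (r * r - x * x); [field; lra|lra]. }
  pose proof (acos_bound (x / r)) as Hb.
  destruct (Rle_dec 0 y) as [Hy|Hy].
  - exists (acos (x / r)); split; [lra|].
    unfold circle; rewrite Hc, Hs, Rabs_pos_eq; auto.
  - exists (2 * PI - acos (x / r)); split; [lra|].
    unfold circle.
    replace (2 * PI - acos (x / r)) with (- acos (x / r) + 2 * PI) by ring.
    replace (cos (- acos (x / r) + 2 * PI)) with (cos (- acos (x / r) + 2 * INR 1 * PI))
      by (simpl; f_equal; ring).
    replace (sin (- acos (x / r) + 2 * PI)) with (sin (- acos (x / r) + 2 * INR 1 * PI))
      by (simpl; f_equal; ring).
    rewrite cos_period, sin_period, cos_neg, sin_neg, Hc.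
    f_equal. rewrite Rabs_left in Hs by lra. lra.
Qed.

Definition punctured_analytic (u : C -> C) : Prop :=
  forall z, in_disk z -> Ccontinuous u z /\ (z <> RtoC 0 -> ex_Cderive u z).

Lemma Ccontinuous_ext_loc (f g : C -> C) (z : C) (r : R) :
  0 < r -> (forall w, Cmod (w - z) < r -> f w = g w) ->
  Ccontinuous f z -> Ccontinuous g z.
Proof.
  intros Hr H Hf; apply Ccontinuous_eps; intros eps He.
  destruct (proj1 (Ccontinuous_eps _ _) Hf eps He) as [d [Hd K]].
  exists (Rmin d r); split; [apply Rmin_glb_lt; lra|]; intros w Hw.
  rewrite <- !H.
  - apply K; eapply Rlt_le_trans; [exact Hw|apply Rmin_l].
  - replace (z - z)%C with (RtoC 0) by ring; rewrite Cmod_0; exact Hr.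
  - eapply Rlt_le_trans; [exact Hw|apply Rmin_r].
Qed.

Lemma Cmod_minus_rev (z w : C) : Cmod (z - w) = Cmod (w - z).
Proof. rewrite <- Cmod_opp; f_equal; ring. Qed.

Lemma Cmod_minus_ge (z w : C) : Cmod z - Cmod w <= Cmod (z - w).
Proof.
  assert (Cmod z <= Cmod (z - w) + Cmod w); [|lra].
  replace z with ((z - w) + w)%C at 1 by ring. apply Cmod_triangle.
Qed.

Lemma neq_of_Cmod_lt (z w : C) : Cmod w < Cmod z -> (z - w)%C <> RtoC 0.
Proof. intros H; apply Cmod_gt_0; pose proof (Cmod_minus_ge z w); lra. Qed.

(** With zeta = [circle r t], the form dzeta / (zeta - c) is i times this weight times dt. *)
Definition cauchy_weight (c : C) (r t : R) : C := (circle r t / (circle r t - c))%C.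

Lemma path_continuous_cauchy_weight (c : C) (r t : R) :
  0 <= r -> Cmod c < r -> path_continuous (cauchy_weight c r) t.
Proof.
  intros Hr Hc.
  apply (path_continuous_comp (fun z => z * / (z - c))%C (circle r));
    [apply path_continuous_circle|].
  apply Ccontinuous_mult; [apply continuous_id|].
  apply Ccontinuous_inv.
  - apply Ccontinuous_minus; [apply continuous_id|apply Ccontinuous_const].
  - apply neq_of_Cmod_lt; rewrite Cmod_circle; lra.
Qed.

Lemma Cmod_cauchy_weight_le (c : C) (r t : R) :
  0 <= r -> Cmod c < r -> Cmod (cauchy_weight c r t) <= r / (r - Cmod c).
Proof.
  intros Hr Hc; unfold cauchy_weight.
  assert (Hn : Cmod c < Cmod (circle r t)) by (rewrite Cmod_circle; lra).
  rewrite Cmod_div by (apply neq_of_Cmod_lt, Hn).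
  pose proof (Cmod_minus_ge (circle r t) c) as K.
  rewrite Cmod_circle in * by lra.
  apply Rmult_le_compat_l; [lra|]. apply Rinv_le_contravar; lra.
Qed.

Lemma path_continuous_on_circle (u : C -> C) (r t : R) :
  punctured_analytic u -> 0 <= r < 1 -> path_continuous (fun s => u (circle r s)) t.
Proof.
  intros Hu Hr; apply path_continuous_comp; [apply path_continuous_circle|].
  apply Hu; unfold in_disk; rewrite Cmod_circle; lra.
Qed.

Lemma ex_CInt_cauchy (u : C -> C) (c : C) (r : R) :
  punctured_analytic u -> r < 1 -> Cmod c < r ->
  ex_CInt (fun t => cauchy_weight c r t * u (circle r t))%C 0 (2 * PI).
Proof.
  intros Hu Hr Hc; pose proof (Cmod_ge_0 c).
  apply ex_CInt_continuous; intros t _; apply path_continuous_mult.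
  - apply path_continuous_cauchy_weight; lra.
  - apply path_continuous_on_circle; auto; lra.
Qed.

(* The difference quotient (u(z) - u(c)) / (z - c) has a primitive, so its
   integral along a closed circle vanishes. *)
Lemma cauchy_formula (u : C -> C) (c : C) (r : R) :
  punctured_analytic u -> r < 1 -> Cmod c < r -> c <> RtoC 0 ->
  CInt (fun t => cauchy_weight c r t * u (circle r t))%C 0 (2 * PI)
  = (u c * CInt (cauchy_weight c r) 0 (2 * PI))%C.
Proof.
  intros Hu Hr Hc Hc0; pose proof (Cmod_ge_0 c) as Hc1.
  assert (Dc : in_disk c) by (unfold in_disk; lra).
  destruct (proj2 (Hu c Dc) Hc0) as [l Hl].
  set (k := fun z => if Ceq_dec z c then (l : C) else ((u z - u c) / (z - c))%C).
  assert (Hk : forall z, z <> c -> k z = ((u z - u c) / (z - c))%C).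
  { intros z Hz; unfold k; destruct (Ceq_dec z c); [contradiction|reflexivity]. }
  assert (Hloc : forall z, z <> c -> 0 < Cmod (z - c) /\ forall w, Cmod (w - z) < Cmod (z - c) ->
    ((u w - u c) / (w - c))%C = k w).
  { intros z Hz; split; [apply Cmod_gt_0; apply Cminus_eq_contra, Hz|].
    intros w Hw; symmetry; apply Hk; intros ->.
    rewrite Cmod_minus_rev in Hw; lra. }
  (* Two exceptional points: at 0 nothing beyond continuity is known of [u], and at [c] the
     difference quotient is filled in by the derivative [l], which gives continuity only. *)
  destruct (primitive_in_disk k [RtoC 0; c]) as [K HK].
  - intros z Hz; destruct (Ceq_dec z c) as [->|Hzc].
    + apply Ccontinuous_eps; intros eps He.
      destruct (proj1 (is_Cderive_eps _ _ _) Hl (eps / 2)) as [d [Hd Kd]]; [lra|].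
      exists d; split; [exact Hd|]; intros w Hw.
      destruct (Ceq_dec w c) as [->|Hwc].
      { unfold Cminus; rewrite Cplus_opp_r, Cmod_0; exact He. }
      rewrite (Hk w Hwc); unfold k; destruct (Ceq_dec c c) as [_|N]; [|contradiction].
      assert (Hn : (w - c)%C <> RtoC 0) by (apply Cminus_eq_contra, Hwc).
      assert (Hp : 0 < Cmod (w - c)) by (apply Cmod_gt_0, Hn).
      replace ((u w - u c) / (w - c) - l)%C with ((u w - u c - (w - c) * l) / (w - c))%C
        by (field; exact Hn).
      rewrite Cmod_div by exact Hn.
      apply Rle_lt_trans with (eps / 2); [|lra].
      apply Rmult_le_reg_r with (Cmod (w - c)); [exact Hp|].
      unfold Rdiv at 1; rewrite Rmult_assoc, Rinv_l, Rmult_1_r by lra.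
      apply Kd, Hw.
    + destruct (Hloc z Hzc) as [Hp Hw].
      apply (Ccontinuous_ext_loc _ k z _ Hp Hw).
      apply Ccontinuous_mult.
      * apply Ccontinuous_minus; [apply Hu, Hz|apply Ccontinuous_const].
      * apply Ccontinuous_inv; [|apply Cminus_eq_contra, Hzc].
        apply Ccontinuous_minus; [apply continuous_id|apply Ccontinuous_const].
  - intros z Hz Hn.
    assert (Hz0 : z <> RtoC 0) by (intros ->; apply Hn; simpl; auto).
    assert (Hzc : z <> c) by (intros ->; apply Hn; simpl; auto).
    destruct (Hloc z Hzc) as [Hp Hw].
    destruct (proj2 (Hu z Hz) Hz0) as [a Ha].
    eexists; apply (is_Cderive_ext_loc _ k z _ _ Hp Hw).
    Cderive. apply Cminus_eq_contra, Hzc.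
  - assert (Hdisk : forall t, in_disk (circle r t)).
    { intros t; unfold in_disk; rewrite Cmod_circle; lra. }
    assert (Hne : forall t, circle r t <> c).
    { intros t E; pose proof (Cmod_circle r t ltac:(lra)) as K1; rewrite E in K1; lra. }
    assert (Ek : forall s, (Ci * circle r s * k (circle r s))%C
                           = (Ci * (cauchy_weight c r s * (u (circle r s) - u c)))%C).
    { intros s; rewrite Hk by apply Hne; unfold cauchy_weight; field.
      apply Cminus_eq_contra, Hne. }
    assert (Pk : forall s, path_continuous (fun s => Ci * circle r s * k (circle r s))%C s).
    { intros s; apply (continuous_ext _ _ s (fun s => eq_sym (Ek s))).
      apply path_continuous_mult; [apply continuous_const|].
      apply path_continuous_mult; [apply path_continuous_cauchy_weight; lra|].
      apply (path_continuous_comp (fun z => u z - u c)%C);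
        [apply path_continuous_circle|].
      apply Ccontinuous_minus; [apply Hu, Hdisk|apply Ccontinuous_const]. }
    assert (E : CInt (fun t => Ci * circle r t * k (circle r t))%C 0 (2 * PI) = RtoC 0).
    { rewrite (CInt_derive (fun t => K (circle r t))).
      - unfold circle; rewrite cos_2PI, sin_2PI, cos_0, sin_0. apply Cplus_opp_r.
      - intros t _; apply (is_path_derive_comp K); [apply is_path_derive_circle|].
        apply HK, Hdisk.
      - auto. }
    assert (Hw : ex_CInt (cauchy_weight c r) 0 (2 * PI)).
    { apply ex_CInt_continuous; intros t _; apply path_continuous_cauchy_weight; lra. }
    assert (Hi := ex_CInt_cauchy u c r Hu Hr Hc).
    rewrite <- CInt_Cmult by exact Hw.
    apply Ceq_minus. rewrite <- CInt_minus; [|exact Hi|].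
    2:{ apply ex_CInt_continuous; intros t _; apply path_continuous_mult;
        [apply continuous_const|apply path_continuous_cauchy_weight; lra]. }
    (* The contour integral of [k] carries a factor i from the derivative of [circle]; multiplying
       by -i leaves the integral of the weight times u - u(c). *)
    replace (RtoC 0) with (- Ci * RtoC 0)%C by ring. rewrite <- E.
    rewrite <- CInt_Cmult by (apply ex_CInt_continuous; auto).
    apply (RInt_ext (V := C_R_CompleteNormedModule)); intros t _.
    match goal with |- ?a = ?b => change (@eq C a b) end.
    rewrite Ek, Cmult_assoc.
    replace (- Ci * Ci)%C with (RtoC 1)
      by (unfold Ci, RtoC, Cmult, Copp; simpl; f_equal; ring).
    ring.
Qed.

(** The weight is 1 / (1 - c / zeta) with |c / zeta| < 1, and w -> 1 / (1 - w) maps the unit disk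
    into the half-plane Re > 1/2. *)
Lemma Re_cauchy_weight_ge (c : C) (r t : R) :
  0 <= r -> Cmod c < r -> / 2 <= Re (cauchy_weight c r t).
Proof.
  intros Hr Hc; unfold cauchy_weight.
  assert (Hn : Cmod c < Cmod (circle r t)) by (rewrite Cmod_circle; lra).
  pose proof (proj1 (Cmod_gt_0 _) (neq_of_Cmod_lt _ _ Hn)) as Hp.
  pose proof (Cmod_ge_0 c) as Hc0.
  assert (Q : Cmod c ^ 2 <= Cmod (circle r t) ^ 2) by (apply pow_incr; lra).
  pose proof (pow_lt _ 2 Hp) as Hp2.
  rewrite !Cmod2_alt in Q; rewrite Cmod2_alt in Hp2.
  destruct (circle r t) as [x y]; destruct c as [a b]. simpl in *.
  match goal with |- _ <= ?X =>
    replace X with ((x * (x - a) + y * (y - b)) / ((x - a) * (x - a) + (y - b) * (y - b))) end.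
  2:{ field. intros E; nra. }
  apply Rmult_le_reg_r with ((x - a) * (x - a) + (y - b) * (y - b)); [nra|].
  unfold Rdiv; rewrite Rmult_assoc, Rinv_l by nra. nra.
Qed.

Lemma Cmod_CInt_cauchy_weight_ge (c : C) (r : R) :
  0 <= r -> Cmod c < r -> PI <= Cmod (CInt (cauchy_weight c r) 0 (2 * PI)).
Proof.
  intros Hr Hc; pose proof PI_RGT_0.
  assert (Hw : ex_CInt (cauchy_weight c r) 0 (2 * PI)).
  { apply ex_CInt_continuous; intros t _; apply path_continuous_cauchy_weight; lra. }
  apply CInt_correct, is_RInt_Re in Hw.
  eapply Rle_trans; [|eapply Rle_trans; [apply Rle_abs|apply re_le_Cmod]].
  apply (is_RInt_le (fun _ => / 2) (fun t => Re (cauchy_weight c r t)) 0 (2 * PI)).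
  - lra.
  - replace PI with (scal (2 * PI - 0) (/ 2)) at 2; [apply (is_RInt_const (V := R_NormedModule))|].
    change ((2 * PI - 0) * / 2 = PI); field.
  - exact Hw.
  - intros t _; apply Re_cauchy_weight_ge; auto.
Qed.

(** The factor 2 is 2 pi / pi: the length of the parameter interval over the lower bound for the
    integral of the weight. *)
Lemma cauchy_estimate (u : C -> C) (c : C) (r m : R) :
  punctured_analytic u -> r < 1 -> Cmod c < r -> c <> RtoC 0 ->
  (forall t, Cmod (u (circle r t)) <= m) ->
  Cmod (u c) <= 2 * m * (r / (r - Cmod c)).
Proof.
  intros Hu Hr Hc Hc0 Hm; pose proof (Cmod_ge_0 c); pose proof PI_RGT_0.
  assert (Hm0 : 0 <= m) by (eapply Rle_trans; [apply Cmod_ge_0|apply (Hm 0)]).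
  assert (Hq : 0 <= r / (r - Cmod c)).
  { left; apply Rdiv_lt_0_compat; lra. }
  pose proof (Cmod_CInt_cauchy_weight_ge c r ltac:(lra) Hc) as Hge.
  assert (K : Cmod (u c) * Cmod (CInt (cauchy_weight c r) 0 (2 * PI))
              <= r / (r - Cmod c) * m * Rabs (2 * PI - 0)).
  { rewrite <- Cmod_mult, <- cauchy_formula by auto.
    apply Cmod_CInt_le; [apply ex_CInt_cauchy; auto|].
    intros t _; rewrite Cmod_mult.
    apply Rmult_le_compat; try apply Cmod_ge_0; [apply Cmod_cauchy_weight_le; lra|auto]. }
  rewrite Rabs_pos_eq in K by lra.
  pose proof (Cmod_ge_0 (u c)).
  apply Rmult_le_reg_r with PI; [lra|]. nra.
Qed.

(** A first form of Schwarz's lemma with a lossy constant, which bounds u(z) / z near 0. Since the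
    weight at b differs from 1 by b / (zeta - b), the product of u(b) with the integral of the
    weight is within O(|b|) of the mean integral [I]. Letting b tend to 0 gives [I] = 0, because
    u(b) tends to 0; then b = c gives the estimate. *)
Lemma vanishing_estimate (u : C -> C) (c : C) (r m : R) :
  punctured_analytic u -> u (RtoC 0) = RtoC 0 -> 0 < r < 1 -> Cmod c < r -> c <> RtoC 0 ->
  (forall t, Cmod (u (circle r t)) <= m) ->
  Cmod (u c) <= 2 * m / (r - Cmod c) * Cmod c.
Proof.
  intros Hu Hu0 Hr Hc Hc0 Hm; pose proof PI_RGT_0.
  assert (Hm0 : 0 <= m) by (eapply Rle_trans; [apply Cmod_ge_0|apply (Hm 0)]).
  set (I := CInt (fun t => u (circle r t)) 0 (2 * PI)).
  assert (HI : ex_CInt (fun t => u (circle r t)) 0 (2 * PI)).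
  { apply ex_CInt_continuous; intros t _; apply path_continuous_on_circle; auto; lra. }
  assert (D : forall b, Cmod b < r -> b <> RtoC 0 ->
    Cmod (u b * CInt (cauchy_weight b r) 0 (2 * PI) - I)
      <= Cmod b / (r - Cmod b) * m * (2 * PI)).
  { intros b Hb Hb0. rewrite <- cauchy_formula by (auto; lra).
    unfold I; rewrite <- CInt_minus by (auto; apply ex_CInt_cauchy; auto; lra).
    pose proof (Cmod_ge_0 b) as Hb1.
    assert (E : Cmod b / (r - Cmod b) * m * (2 * PI)
                = Cmod b / (r - Cmod b) * m * Rabs (2 * PI - 0)).
    { rewrite Rabs_pos_eq by lra; ring. }
    rewrite E; apply Cmod_CInt_le.
    - apply (ex_RInt_minus (V := C_R_NormedModule)
        (fun t => cauchy_weight b r t * u (circle r t))%C (fun t => u (circle r t)));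
        [apply ex_CInt_cauchy; auto; lra|exact HI].
    - intros t _.
      assert (Hn : Cmod b < Cmod (circle r t)) by (rewrite Cmod_circle; lra).
      pose proof (neq_of_Cmod_lt _ _ Hn) as Hn0.
      change (minus ?a ?b) with (a - b)%C.
      replace (cauchy_weight b r t * u (circle r t) - u (circle r t))%C
        with (b / (circle r t - b) * u (circle r t))%C
        by (unfold cauchy_weight; field; exact Hn0).
      rewrite Cmod_mult, Cmod_div by exact Hn0.
      pose proof (Cmod_minus_ge (circle r t) b) as K; rewrite Cmod_circle in K by lra.
      apply Rmult_le_compat; try apply Cmod_ge_0; auto.
      + apply Rmult_le_pos; [lra|]. left; apply Rinv_0_lt_compat; lra.
      + apply Rmult_le_compat_l; [lra|]. apply Rinv_le_contravar; lra. }
  assert (I0 : I = RtoC 0).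
  { apply Cmod_eq_0, Rle_antisym; [|apply Cmod_ge_0].
    apply le_epsilon; intros eps He; rewrite Rplus_0_l.
    assert (D0 : in_disk (RtoC 0)) by (unfold in_disk; rewrite Cmod_0; lra).
    destruct (proj1 (Ccontinuous_eps _ _) (proj1 (Hu _ D0)) (eps / (8 * PI))) as [d [Hd K]].
    { apply Rdiv_lt_0_compat; lra. }
    (* The test point is b = e. The bound d / 2 makes |u(b)| small, r / 2 bounds the weight by 2,
       and the last one makes the O(|b|) term at most eps / 2. *)
    set (e := Rmin (Rmin (d / 2) (r / 2)) (eps / 2 * r / (4 * PI * (m + 1)))).
    assert (E0 : 0 < e).
    { unfold e; repeat apply Rmin_glb_lt; try lra.
      apply Rdiv_lt_0_compat; nra. }
    assert (E1 : e <= d / 2) by (eapply Rle_trans; [apply Rmin_l|apply Rmin_l]).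
    assert (E2 : e <= r / 2) by (eapply Rle_trans; [apply Rmin_l|apply Rmin_r]).
    assert (E3 : e <= eps / 2 * r / (4 * PI * (m + 1))) by apply Rmin_r.
    set (b := RtoC e).
    assert (Hb : Cmod b = e) by (unfold b; rewrite Cmod_R; apply Rabs_pos_eq; lra).
    assert (Hb0 : b <> RtoC 0) by (apply Cmod_gt_0; lra).
    specialize (D b ltac:(lra) Hb0). rewrite Hb in D.
    specialize (K b). rewrite Hu0 in K.
    replace (b - RtoC 0)%C with b in K by ring.
    replace (u b - RtoC 0)%C with (u b) in K by ring.
    specialize (K ltac:(lra)).
    assert (W : Cmod (CInt (cauchy_weight b r) 0 (2 * PI)) <= 2 * Rabs (2 * PI - 0)).
    { apply Cmod_CInt_le.
      - apply ex_CInt_continuous; intros t _; apply path_continuous_cauchy_weight; lra.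
      - intros t _; eapply Rle_trans; [apply Cmod_cauchy_weight_le; lra|].
        rewrite Hb. apply Rmult_le_reg_r with (r - e); [lra|].
        unfold Rdiv; rewrite Rmult_assoc, Rinv_l by lra. lra. }
    rewrite Rabs_pos_eq in W by lra.
    replace I with (u b * CInt (cauchy_weight b r) 0 (2 * PI)
      - (u b * CInt (cauchy_weight b r) 0 (2 * PI) - I))%C by ring.
    eapply Rle_trans; [apply Cmod_triangle|]. rewrite Cmod_opp, Cmod_mult.
    assert (A1 : Cmod (u b) * Cmod (CInt (cauchy_weight b r) 0 (2 * PI)) <= eps / 2).
    { apply Rle_trans with (eps / (8 * PI) * (4 * PI)).
      - apply Rmult_le_compat; try apply Cmod_ge_0; lra.
      - right; field; lra. }
    assert (A2 : e / (r - e) * m * (2 * PI) <= eps / 2).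
    { apply Rle_trans with (e / (r / 2) * (m + 1) * (2 * PI)).
      - apply Rmult_le_compat_r; [lra|]. apply Rmult_le_compat; try lra.
        + left; apply Rdiv_lt_0_compat; lra.
        + apply Rmult_le_compat_l; [lra|]. apply Rinv_le_contravar; lra.
      - apply Rle_trans with (eps / 2 * r / (4 * PI * (m + 1)) / (r / 2) * (m + 1) * (2 * PI)).
        + apply Rmult_le_compat_r; [lra|]. apply Rmult_le_compat_r; [lra|].
          apply Rmult_le_compat_r; [|exact E3]. left; apply Rinv_0_lt_compat; lra.
        + right; field; lra. }
    lra. }
  specialize (D c Hc Hc0). rewrite I0 in D.
  match type of D with Cmod (?a - _) <= _ =>
    replace (a - RtoC 0)%C with a in D by ring end.
  rewrite Cmod_mult in D.
  pose proof (Cmod_CInt_cauchy_weight_ge c r ltac:(lra) Hc) as Hge.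
  pose proof (Cmod_ge_0 (u c)).
  apply Rmult_le_reg_r with PI; [lra|].
  apply Rle_trans with (Cmod (u c) * Cmod (CInt (cauchy_weight c r) 0 (2 * PI))); [nra|].
  eapply Rle_trans; [exact D|]. right; field; lra.
Qed.

(** * From Cauchy's estimate to the lemmas of Schwarz and Jack *)

Lemma pow_le_base (a b x y : R) :
  0 <= a -> 0 <= b -> 0 < x -> (forall n, a ^ n * x <= b ^ n * y) -> a <= b.
Proof.
  intros Ha Hb Hx H; destruct (Rle_dec a b) as [|N]; auto; exfalso.
  assert (Hy : x <= y) by (specialize (H O); simpl in H; lra).
  (* If b < a, the powers of b / a eventually fall below x / y, against the hypothesis at that
     exponent. *)
  destruct (pow_lt_1_zero (b / a)) with (y := x / y) as [n Hn].
  - rewrite Rabs_pos_eq; [|apply Rmult_le_pos; [lra|left; apply Rinv_0_lt_compat; lra]].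
    apply Rmult_lt_reg_r with a; [lra|].
    unfold Rdiv; rewrite Rmult_assoc, Rinv_l by lra; lra.
  - apply Rdiv_lt_0_compat; lra.
  - specialize (Hn n (Nat.le_refl n)); specialize (H n).
    assert (Hp : 0 < a ^ n) by (apply pow_lt; lra).
    apply (Rle_lt_trans _ _ _ (Rle_abs _)) in Hn.
    unfold Rdiv in Hn; rewrite Rpow_mult_distr, pow_inv in Hn.
    apply (Rmult_lt_compat_r (a ^ n * y)) in Hn; [|apply Rmult_lt_0_compat; lra].
    replace (b ^ n * / a ^ n * (a ^ n * y)) with (b ^ n * y) in Hn by (field; lra).
    replace (x * / y * (a ^ n * y)) with (a ^ n * x) in Hn by (field; lra).
    lra.
Qed.

(* Applying [cauchy_estimate] to u^(n+1) / z^n and letting n tend to infinity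
   removes its multiplicative constant. *)
Theorem schwarz (u : C -> C) (c : C) (r m : R) :
  punctured_analytic u -> u (RtoC 0) = RtoC 0 -> 0 < r < 1 -> Cmod c < r ->
  (forall t, Cmod (u (circle r t)) <= m) ->
  Cmod (u c) <= m / r * Cmod c.
Proof.
  intros Hu Hu0 Hr Hc Hm.
  assert (Hm0 : 0 <= m) by (eapply Rle_trans; [apply Cmod_ge_0|apply (Hm 0)]).
  assert (Hmr : 0 <= m / r).
  { apply Rmult_le_pos; [lra|]; left; apply Rinv_0_lt_compat; lra. }
  destruct (Ceq_dec c (RtoC 0)) as [->|Hc0].
  { rewrite Hu0, Cmod_0; lra. }
  destruct (Ceq_dec (u c) (RtoC 0)) as [Huc|Huc].
  { rewrite Huc, Cmod_0; apply Rmult_le_pos; [exact Hmr|apply Cmod_ge_0]. }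
  apply Cmod_gt_0 in Huc. pose proof (proj1 (Cmod_gt_0 _) Hc0) as Hcp.
  enough (Cmod (u c) / Cmod c <= m / r).
  { replace (Cmod (u c)) with (Cmod (u c) / Cmod c * Cmod c) by (field; lra).
    apply Rmult_le_compat_r; lra. }
  apply pow_le_base with (x := Cmod (u c)) (y := 2 * m * (r / (r - Cmod c))); auto.
  { left; apply Rdiv_lt_0_compat; lra. }
  intros n.
  (* One more power of u than of z: the ratio u / z is bounded near 0 by [vanishing_estimate], and
     the spare factor u makes g continuous there with value 0. *)
  set (g := fun z => if Ceq_dec z (RtoC 0) then RtoC 0 else (u z * u z ^ n / z ^ n)%C).
  assert (Hg : forall z, z <> RtoC 0 -> g z = (u z * u z ^ n / z ^ n)%C).
  { intros z Hz; unfold g; destruct (Ceq_dec z (RtoC 0)); [contradiction|reflexivity]. }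
  assert (Cg : forall z, z <> RtoC 0 -> Cmod (g z) = (Cmod (u z) / Cmod z) ^ n * Cmod (u z)).
  { intros z Hz; rewrite Hg, Cmod_div, Cmod_mult, !Cmod_pow by (auto using Cpow_nz).
    unfold Rdiv; rewrite Rpow_mult_distr, pow_inv; ring. }
  assert (Lip : forall z, z <> RtoC 0 -> Cmod z < r / 2 -> Cmod (u z) / Cmod z <= 4 * m / r).
  { intros z Hz Hzr. pose proof (proj1 (Cmod_gt_0 _) Hz) as Hzp.
    apply Rmult_le_reg_r with (Cmod z); [lra|].
    unfold Rdiv at 1; rewrite Rmult_assoc, Rinv_l, Rmult_1_r by lra.
    eapply Rle_trans; [apply (vanishing_estimate u z r m); auto; lra|].
    apply Rmult_le_compat_r; [lra|].
    replace (4 * m / r) with (2 * m * / (r / 2)) by (field; lra).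
    apply Rmult_le_compat_l; [lra|]. apply Rinv_le_contravar; lra. }
  assert (Hgp : punctured_analytic g).
  { intros z Hz; destruct (Ceq_dec z (RtoC 0)) as [->|Hz0].
    - split; [|intros N; contradiction].
      apply Ccontinuous_eps; intros eps He.
      set (B := (4 * m / r) ^ n).
      assert (HB : 0 <= B).
      { apply pow_le, Rmult_le_pos; [lra|]; left; apply Rinv_0_lt_compat; lra. }
      destruct (proj1 (Ccontinuous_eps _ _) (proj1 (Hu _ Hz)) (eps / (B + 1))) as [d [Hd K]].
      { apply Rdiv_lt_0_compat; lra. }
      exists (Rmin d (r / 2)); split; [apply Rmin_glb_lt; lra|]; intros w Hw.
      assert (Eg : g (RtoC 0) = RtoC 0).
      { unfold g; destruct (Ceq_dec (RtoC 0) (RtoC 0)); [reflexivity|contradiction]. }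
      rewrite Eg; replace (g w - RtoC 0)%C with (g w) by ring.
      destruct (Ceq_dec w (RtoC 0)) as [->|Hw0].
      { rewrite Eg, Cmod_0; exact He. }
      assert (Hw1 : Cmod w < r / 2).
      { replace w with (w - RtoC 0)%C by ring.
        eapply Rlt_le_trans; [exact Hw|apply Rmin_r]. }
      specialize (K w (Rlt_le_trans _ _ _ Hw (Rmin_l _ _))).
      rewrite Hu0 in K; replace (u w - RtoC 0)%C with (u w) in K by ring.
      rewrite Cg by exact Hw0.
      pose proof (proj1 (Cmod_gt_0 _) Hw0) as Hwp. pose proof (Cmod_ge_0 (u w)).
      apply Rle_lt_trans with (B * Cmod (u w)).
      { apply Rmult_le_compat_r; [lra|]. apply pow_incr; split; [|apply Lip; auto].
        apply Rmult_le_pos; [lra|]; left; apply Rinv_0_lt_compat; lra. }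
      apply Rle_lt_trans with ((B + 1) * Cmod (u w)); [nra|].
      apply Rlt_le_trans with ((B + 1) * (eps / (B + 1))).
      { apply Rmult_lt_compat_l; lra. }
      right; field; lra.
    - assert (Hd : ex_Cderive g z).
      { destruct (proj2 (Hu z Hz) Hz0) as [a Ha].
        destruct (ex_Cderive_pow u z n) as [b Hb]; [exists a; exact Ha|].
        destruct (ex_Cderive_pow (fun w => w) z n) as [e He];
          [exists (RtoC 1); apply is_Cderive_id|].
        eexists; apply (is_Cderive_ext_loc (fun w => u w * u w ^ n / w ^ n)%C g z _ (Cmod z)).
        - apply Cmod_gt_0, Hz0.
        - intros w Hw; symmetry; apply Hg; intros ->.
          rewrite Cmod_minus_rev in Hw; replace (z - RtoC 0)%C with z in Hw by ring; lra.
        - apply (is_Cderive_div (fun w => u w * u w ^ n)%C (fun w => w ^ n)%C);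
            [apply (is_Cderive_mult u (fun w => u w ^ n)%C); eassumption|exact He|].
          apply Cpow_nz, Hz0. }
      split; [|intros _; exact Hd].
      destruct Hd as [l Hl]; eapply is_Cderive_continuous, Hl. }
  rewrite <- Cg by exact Hc0.
  eapply Rle_trans; [apply (cauchy_estimate g c r ((m / r) ^ n * m)); auto; try lra|].
  - intros t.
    assert (H0 : circle r t <> RtoC 0) by (apply Cmod_gt_0; rewrite Cmod_circle; lra).
    rewrite Cg by exact H0; rewrite Cmod_circle by lra.
    specialize (Hm t); pose proof (Cmod_ge_0 (u (circle r t))).
    apply Rmult_le_compat; auto.
    + apply pow_le, Rmult_le_pos; [lra|]; left; apply Rinv_0_lt_compat; lra.
    + apply pow_incr; split.
      * apply Rmult_le_pos; [lra|]; left; apply Rinv_0_lt_compat; lra.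
      * apply Rmult_le_compat_r; [left; apply Rinv_0_lt_compat; lra|exact Hm].
  - right; ring.
Qed.

Lemma Re_mult_conj_le (z w : C) : Re (z * Cconj w) <= Cmod z * Cmod w.
Proof.
  eapply Rle_trans; [apply Rle_abs|].
  eapply Rle_trans; [apply re_le_Cmod|].
  rewrite Cmod_mult, Cmod_conj; lra.
Qed.

Lemma Re_mult_conj_self (z : C) : Re (z * Cconj z) = Cmod z ^ 2.
Proof. rewrite Cmod2_alt; destruct z; simpl; ring. Qed.

(* Jack's lemma: at a point of maximum modulus on a circle, Schwarz's lemma
   bounds the radial derivative of |u| from below. *)
Lemma jack (u : C -> C) (z0 l : C) :
  punctured_analytic u -> u (RtoC 0) = RtoC 0 -> in_disk z0 -> z0 <> RtoC 0 ->
  (forall t, Cmod (u (circle (Cmod z0) t)) <= Cmod (u z0)) ->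
  is_Cderive u z0 l ->
  Cmod (u z0) ^ 2 <= Re (z0 * l * Cconj (u z0)).
Proof.
  intros Hu Hu0 Hz Hz0 Hmax Hl.
  apply Cmod_gt_0 in Hz0; unfold in_disk in Hz.
  set (r := Cmod z0) in *; set (a := u z0) in *; set (b := (z0 * l)%C).
  pose proof (Cmod_ge_0 a) as Ha.
  apply le_epsilon; intros eps He.
  (* The first-order error is later multiplied by |a| and by r < 1, hence the division by |a| +
     1. *)
  destruct (proj1 (is_Cderive_eps _ _ _) Hl (eps / (Cmod a + 1))) as [d [Hd K]].
  { apply Rdiv_lt_0_compat; lra. }
  set (s := Rmin (/ 2) (d / 2)).
  assert (S0 : 0 < s) by (apply Rmin_glb_lt; lra).
  assert (S1 : s <= / 2) by apply Rmin_l.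
  assert (S2 : s <= d / 2) by apply Rmin_r.
  (* A step radially inward. Schwarz gives |u(w)| <= (1 - s) |a|, while u(w) is a - s b up to o(s).
     Pairing with the conjugate of a yields |a|^2 - s Re(b conj a) <= (1 - s) |a|^2 + o(s), and
     division by s finishes. *)
  set (w := (RtoC (1 - s) * z0)%C).
  assert (Ew : (w - z0)%C = (RtoC (- s) * z0)%C).
  { unfold w; rewrite RtoC_minus, RtoC_opp; ring. }
  assert (Mw : Cmod (w - z0) = s * r).
  { rewrite Ew, Cmod_mult, Cmod_R, Rabs_Ropp, Rabs_pos_eq; unfold r; lra. }
  assert (Nw : Cmod w = (1 - s) * r).
  { unfold w; rewrite Cmod_mult, Cmod_R, Rabs_pos_eq; unfold r; lra. }
  specialize (K w ltac:(rewrite Mw; nra)). rewrite Mw, Ew in K. fold a in K.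
  assert (S : Cmod (u w) <= (1 - s) * Cmod a).
  { eapply Rle_trans; [apply (schwarz u w r (Cmod a)); auto; try lra; rewrite Nw; nra|].
    rewrite Nw; right; field; lra. }
  assert (T : Cmod (a - RtoC s * b) <= (1 - s) * Cmod a + eps / (Cmod a + 1) * (s * r)).
  { replace (a - RtoC s * b)%C with (u w - (u w - a - RtoC (- s) * z0 * l))%C
      by (unfold b; rewrite RtoC_opp; ring).
    eapply Rle_trans; [apply Cmod_triangle|]; rewrite Cmod_opp; lra. }
  pose proof (Re_mult_conj_le (a - RtoC s * b) a) as Q.
  assert (EQ : Re ((a - RtoC s * b) * Cconj a) = Cmod a ^ 2 - s * Re (b * Cconj a)).
  { rewrite <- Re_mult_conj_self. destruct a, b; simpl; ring. }
  rewrite EQ in Q.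
  assert (F : eps / (Cmod a + 1) * Cmod a <= eps).
  { apply Rle_trans with (eps / (Cmod a + 1) * (Cmod a + 1)).
    - apply Rmult_le_compat_l; [left; apply Rdiv_lt_0_compat; lra|lra].
    - right; field; lra. }
  assert (G : Cmod (a - RtoC s * b) * Cmod a
    <= (1 - s) * Cmod a ^ 2 + s * r * (eps / (Cmod a + 1) * Cmod a)).
  { eapply Rle_trans; [apply Rmult_le_compat_r; [exact Ha|exact T]|]. right; ring. }
  assert (F2 : r * (eps / (Cmod a + 1) * Cmod a) <= eps).
  { assert (0 <= eps / (Cmod a + 1) * Cmod a).
    { apply Rmult_le_pos; [left; apply Rdiv_lt_0_compat; lra|lra]. }
    nra. }
  apply Rmult_le_reg_l with s; [exact S0|]. nra.
Qed.

(** On the circle through z, |u| attains its maximum by compactness of the parameter interval.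
    Jack's inequality holds at the maximum point, so the a priori bound need only be derived from
    that inequality. *)
Theorem jack_bound (u : C -> C) (m : R) :
  punctured_analytic u -> u (RtoC 0) = RtoC 0 -> 0 <= m ->
  (forall z l, in_disk z -> z <> RtoC 0 -> is_Cderive u z l ->
     Cmod (u z) ^ 2 <= Re (z * l * Cconj (u z)) -> Cmod (u z) <= m) ->
  forall z, in_disk z -> Cmod (u z) <= m.
Proof.
  intros Hu Hu0 Hm H z Hz.
  destruct (Ceq_dec z (RtoC 0)) as [->|Hz0].
  { rewrite Hu0, Cmod_0; exact Hm. }
  destruct (circle_surjective z Hz0) as [t [Ht Et]].
  pose proof (proj1 (Cmod_gt_0 _) Hz0) as Hr. unfold in_disk in Hz.
  set (r := Cmod z) in *.
  destruct (continuity_ab_maj (fun s => Cmod (u (circle r s))) 0 (2 * PI)) as [t0 [M0 _]].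
  - pose proof PI_RGT_0; lra.
  - intros s _; apply continuity_pt_filterlim.
    assert (Hs := path_continuous_on_circle u r s Hu ltac:(lra)).
    intros P [e He].
    destruct (proj1 (path_continuous_eps _ _) Hs e (cond_pos e)) as [d [Hd K]].
    exists (mkposreal d Hd); intros y Hy; apply He; specialize (K y Hy).
    apply Rabs_def1.
    + eapply Rle_lt_trans; [apply Cmod_minus_ge|exact K].
    + rewrite Cmod_minus_rev in K.
      pose proof (Cmod_minus_ge (u (circle r s)) (u (circle r y))).
      unfold minus, plus, opp; simpl; lra.
  - assert (Hmax : forall s, Cmod (u (circle r s)) <= Cmod (u (circle r t0))).
    { intros s.
      assert (Hs0 : circle r s <> RtoC 0) by (apply Cmod_gt_0; rewrite Cmod_circle; lra).
      destruct (circle_surjective _ Hs0) as [s' [Hs' Es]].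
      rewrite Cmod_circle in Es by lra. rewrite Es; apply M0, Hs'. }
    set (z0 := circle r t0) in *.
    assert (N0 : Cmod z0 = r) by (apply Cmod_circle; lra).
    assert (Z0 : z0 <> RtoC 0) by (apply Cmod_gt_0; lra).
    assert (D0 : in_disk z0) by (unfold in_disk; lra).
    destruct (proj2 (Hu z0 D0) Z0) as [l Hl].
    apply Rle_trans with (Cmod (u z0)); [rewrite Et; apply Hmax|].
    apply (H z0 l); auto. apply jack; auto. rewrite N0; exact Hmax.
Qed.

(** * The Libera transform *)

Lemma in_disk_segment (z w : C) (t : R) :
  in_disk z -> in_disk w -> 0 <= t <= 1 -> in_disk (w + RtoC t * (z - w))%C.
Proof.
  unfold in_disk; intros Hz Hw Ht.
  replace (w + t * (z - w))%C with (RtoC (1 - t) * w + RtoC t * z)%C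
    by (rewrite RtoC_minus; ring).
  eapply Rle_lt_trans; [apply Cmod_triangle|].
  rewrite !Cmod_mult, !Cmod_R, !Rabs_pos_eq by lra.
  destruct (Rle_dec (Cmod z) (Cmod w)); nra.
Qed.

Lemma CInt_segment (K g : C -> C) (z w : C) :
  in_disk z -> in_disk w ->
  (forall x, in_disk x -> is_Cderive K x (g x)) ->
  (forall x, in_disk x -> Ccontinuous g x) ->
  ex_CInt (fun t => (z - w) * g (w + RtoC t * (z - w)))%C 0 1 /\
  CInt (fun t => (z - w) * g (w + RtoC t * (z - w)))%C 0 1 = (K z - K w)%C.
Proof.
  intros Hz Hw HK Hg.
  assert (D : forall t, Rmin 0 1 <= t <= Rmax 0 1 -> in_disk (w + RtoC t * (z - w))%C).
  { intros t; rewrite Rmin_left, Rmax_right by lra; apply in_disk_segment; auto. }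
  assert (P : forall t, Rmin 0 1 <= t <= Rmax 0 1 ->
    path_continuous (fun t => (z - w) * g (w + RtoC t * (z - w)))%C t).
  { intros t Ht; apply path_continuous_mult; [apply continuous_const|].
    apply (path_continuous_comp g (fun t => w + RtoC t * (z - w))%C).
    - eapply is_path_derive_continuous, is_path_derive_line.
    - apply Hg, D, Ht. }
  split; [apply ex_CInt_continuous, P|].
  rewrite (CInt_derive (fun t => K (w + RtoC t * (z - w))%C)); [| |exact P].
  - f_equal; [f_equal; ring|f_equal; f_equal; ring].
  - intros t Ht; apply (is_path_derive_comp K (fun t => w + RtoC t * (z - w))%C).
    + apply is_path_derive_line.
    + apply HK, D, Ht.
Qed.

(** F - id has derivative at most rho in modulus on the convex disk, so F z = F w forces |z - w| <=
    rho |z - w|. *)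
Lemma univalent_of_derivative_near_1 (F dF : C -> C) (rho : R) :
  rho < 1 ->
  (forall z, in_disk z -> is_Cderive F z (dF z)) ->
  (forall z, in_disk z -> Ccontinuous dF z) ->
  (forall z, in_disk z -> Cmod (dF z - RtoC 1) <= rho) ->
  univalent_in_disk F.
Proof.
  intros Hrho HF Hc Hb z w Hz Hw E.
  destruct (CInt_segment (fun x => F x - x)%C (fun x => dF x - RtoC 1)%C z w Hz Hw)
    as [Ex Ei].
  - intros x Hx; apply is_Cderive_minus; [apply HF, Hx|apply is_Cderive_id].
  - intros x Hx; apply Ccontinuous_minus; [apply Hc, Hx|apply Ccontinuous_const].
  - assert (K := Cmod_CInt_le _ _ _ (Cmod (z - w) * rho) Ex).
    rewrite Ei in K.
    replace (F z - z - (F w - w))%C with (- (z - w))%C in K by (rewrite E; ring).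
    rewrite Cmod_opp, Rminus_0_r, Rabs_R1 in K.
    assert (K1 : Cmod (z - w) <= Cmod (z - w) * rho * 1).
    { apply K; intros t; rewrite Rmin_left, Rmax_right by lra; intros Ht.
      rewrite Cmod_mult; apply Rmult_le_compat_l; [apply Cmod_ge_0|].
      apply Hb, in_disk_segment; auto. }
    pose proof (Cmod_ge_0 (z - w)).
    apply Ceq_minus, Cmod_eq_0. nra.
Qed.

(** Squaring turns the hypothesis into |s|^2 < 2 Re(q conj s), that is, Re((2 q - s) conj s) > 0. *)
Lemma Re_quotient_pos (s q : C) :
  s <> RtoC 0 -> Cmod (s - q) < Cmod q -> 0 < Re ((RtoC 2 * q - s) / s)%C.
Proof.
  intros Hs H.
  assert (Q : Cmod (s - q) ^ 2 < Cmod q ^ 2).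
  { pose proof (Cmod_ge_0 (s - q)); simpl; nra. }
  apply Cmod_gt_0 in Hs. pose proof (pow_lt _ 2 Hs) as P.
  rewrite !Cmod2_alt in Q; rewrite Cmod2_alt in P.
  destruct s as [a b], q as [c d]; simpl in *.
  match goal with |- _ < ?X =>
    replace X with (((2 * c - a) * a + (2 * d - b) * b) / (a * a + b * b)) end.
  2:{ field; intros E; nra. }
  apply Rdiv_lt_0_compat; nra.
Qed.

Section LiberaTransform.

Variables (M : R) (f : C -> C).
Hypothesis HM : 0 < M < sqrt 2 - 1.
Hypothesis Hf : class_S M f.

(** The product (sqrt 2 - 1 - M)(sqrt 2 + 1 + M) equals 2 - (1 + M)^2. *)
Lemma M_quadratic : M * M + 2 * M < 1.
Proof.
  assert (sqrt 2 * sqrt 2 = 2) by (apply sqrt_sqrt; lra).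
  assert (0 < (sqrt 2 - 1 - M) * (sqrt 2 + 1 + M)); [|nra].
  apply Rmult_lt_0_compat; lra.
Qed.

(** A rational number between sqrt 2 - 1 and 2 - sqrt(10)/2, so that later inequalities in M are
    free of square roots. *)
Lemma M_lt : M < 415 / 1000.
Proof. pose proof M_quadratic; nra. Qed.

Lemma f_derive (z : C) : in_disk z -> is_Cderive f z (C_derive f z).
Proof.
  intros Hz; destruct Hf as [[Ha _] _].
  apply C_derive_correct; [exact z|apply Ha, Hz].
Qed.

Lemma f_continuous (z : C) : in_disk z -> Ccontinuous f z.
Proof. intros Hz; eapply is_Cderive_continuous, f_derive, Hz. Qed.

Lemma in_disk_0 : in_disk (RtoC 0).
Proof. unfold in_disk; rewrite Cmod_0; lra. Qed.

Lemma f_nonzero (z : C) : in_disk z -> z <> RtoC 0 -> f z <> RtoC 0.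
Proof. apply Hf. Qed.

Definition starlike_ratio (z : C) : C := (z * C_derive f z / f z)%C.

Lemma starlike_ratio_bound (z : C) : in_disk z -> z <> RtoC 0 -> Cmod (starlike_ratio z - RtoC 1) < M.
Proof.
  intros Hz Hz0; destruct Hf as [_ [_ H]]; specialize (H z Hz).
  unfold starlike_quotient in H; destruct (Ceq_dec z (RtoC 0)); [contradiction|exact H].
Qed.

Variable G : C -> C.
Hypothesis G_derive : forall z, in_disk z -> is_Cderive G z (f z).

Let f_int (z : C) : C := (G z - G (RtoC 0))%C.

Lemma f_int_derive (z : C) : in_disk z -> is_Cderive f_int z (f z).
Proof.
  intros Hz; pose proof (G_derive z Hz) as HG.
  unfold f_int; eapply is_Cderive_eq; [Cderive|ring].
Qed.

Lemma integral_from_0_eq (z : C) : in_disk z -> integral_from_0 f z = f_int z.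
Proof.
  intros Hz.
  destruct (CInt_segment G f z (RtoC 0) Hz in_disk_0 G_derive f_continuous) as [Ex Ei].
  unfold integral_from_0, f_int; rewrite <- Ei.
  assert (E : forall t : R, ((z - 0) * f (0 + t * (z - 0)))%C = (f (t * z) * z)%C).
  { intros t; replace (0 + t * (z - 0))%C with (t * z)%C by ring; ring. }
  rewrite C_RInt_CInt.
  - apply (RInt_ext (V := C_R_CompleteNormedModule)); intros t _; symmetry; apply E.
  - apply (ex_RInt_ext (V := C_R_NormedModule)
             (fun t => (z - 0) * f (0 + RtoC t * (z - 0)))%C); [|exact Ex].
    intros t _; apply E.
Qed.

Lemma f_asymptotic (eps : R) : 0 < eps ->
  exists d, 0 < d <= 1 /\ forall z, Cmod z < d -> Cmod (f z - z) <= eps * Cmod z.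
Proof.
  intros He; pose proof (f_derive _ in_disk_0) as H.
  destruct Hf as [[_ [H0 H1]] _]; rewrite H1 in H.
  destruct (proj1 (is_Cderive_eps _ _ _) H eps He) as [d [Hd K]].
  exists (Rmin d 1); split; [split; [apply Rmin_glb_lt; lra|apply Rmin_r]|].
  intros z Hz; specialize (K z); rewrite H0 in K.
  replace (f z - 0 - (z - 0) * 1)%C with (f z - z)%C in K by ring.
  replace (z - 0)%C with z in K by ring.
  apply K; eapply Rlt_le_trans; [exact Hz|apply Rmin_l].
Qed.

(** Integrating f(x) - x = o(x) along the segment from 0 to z gives the second-order expansion of
    the primitive. It supplies both the continuity of [Lf_dev] and the derivative of [Libera f] at
    0. *)
Lemma f_int_asymptotic (eps : R) : 0 < eps ->
  exists d, 0 < d <= 1 /\ forall z, Cmod z < d ->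
    Cmod (f z - z) <= eps * Cmod z /\
    Cmod (RtoC 2 * f_int z - z * z) <= 2 * eps * (Cmod z * Cmod z).
Proof.
  intros He; destruct (f_asymptotic eps He) as [d [Hd K]].
  exists d; split; [exact Hd|]; intros z Hz; split; [apply K, Hz|].
  assert (Dz : in_disk z) by (unfold in_disk; lra).
  destruct (CInt_segment (fun x => G x - / 2 * (x * x))%C (fun x => f x - x)%C z (RtoC 0)
    Dz in_disk_0) as [Ex Ei].
  - intros x Hx; pose proof (G_derive x Hx) as HG.
    eapply is_Cderive_eq; [Cderive|]. field; intros E; injection E; lra.
  - intros x Hx; apply Ccontinuous_minus; [apply f_continuous, Hx|apply continuous_id].
  - replace (RtoC 2 * f_int z - z * z)%C
      with (RtoC 2 * (G z - / 2 * (z * z) - (G (RtoC 0) - / 2 * (RtoC 0 * RtoC 0))))%C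
      by (unfold f_int; field; intros E; injection E; lra).
    rewrite <- Ei, Cmod_mult, Cmod_R, Rabs_pos_eq by lra.
    rewrite Rmult_assoc; apply Rmult_le_compat_l; [lra|].
    replace (eps * (Cmod z * Cmod z)) with (Cmod z * (eps * Cmod z) * Rabs (1 - 0))
      by (rewrite Rminus_0_r, Rabs_R1; ring).
    apply Cmod_CInt_le; [exact Ex|].
    intros t; rewrite Rmin_left, Rmax_right by lra; intros Ht.
    replace (z - 0)%C with z by ring.
    replace (0 + t * z)%C with (t * z)%C by ring.
    rewrite Cmod_mult; apply Rmult_le_compat_l; [apply Cmod_ge_0|].
    pose proof (Cmod_ge_0 z).
    assert (T : Cmod (t * z) <= Cmod z).
    { rewrite Cmod_mult, Cmod_R, Rabs_pos_eq by lra; nra. }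
    eapply Rle_trans; [apply K; lra|]. apply Rmult_le_compat_l; lra.
Qed.

(* The deviations of f(z)/z and of L(f)(z)/f(z) from 1. They are continuous at
   0, and their differentiability there is never needed. *)
Definition fz_dev (z : C) : C :=
  if Ceq_dec z (RtoC 0) then RtoC 0 else (f z / z - RtoC 1)%C.

Definition Lf_dev (z : C) : C :=
  if Ceq_dec z (RtoC 0) then RtoC 0 else (RtoC 2 * f_int z / (z * f z) - RtoC 1)%C.

Lemma fz_dev_0 : fz_dev (RtoC 0) = RtoC 0.
Proof. unfold fz_dev; destruct (Ceq_dec (RtoC 0) (RtoC 0)); [reflexivity|contradiction]. Qed.

Lemma Lf_dev_0 : Lf_dev (RtoC 0) = RtoC 0.
Proof. unfold Lf_dev; destruct (Ceq_dec (RtoC 0) (RtoC 0)); [reflexivity|contradiction]. Qed.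

Lemma fz_dev_eq (z : C) : z <> RtoC 0 -> fz_dev z = (f z / z - RtoC 1)%C.
Proof. intros H; unfold fz_dev; destruct (Ceq_dec z (RtoC 0)); [contradiction|reflexivity]. Qed.

Lemma Lf_dev_eq (z : C) : z <> RtoC 0 -> Lf_dev z = (RtoC 2 * f_int z / (z * f z) - RtoC 1)%C.
Proof. intros H; unfold Lf_dev; destruct (Ceq_dec z (RtoC 0)); [contradiction|reflexivity]. Qed.

Lemma nonzero_near (z w : C) : Cmod (w - z) < Cmod z -> w <> RtoC 0.
Proof.
  intros H ->; rewrite Cmod_minus_rev in H.
  replace (z - RtoC 0)%C with z in H by ring; lra.
Qed.

Lemma fz_dev_derive (z : C) : in_disk z -> z <> RtoC 0 ->
  exists l, is_Cderive fz_dev z l /\ (z * l)%C = ((RtoC 1 + fz_dev z) * (starlike_ratio z - RtoC 1))%C.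
Proof.
  intros Hz Hz0; pose proof (f_derive z Hz) as H1; pose proof (f_nonzero z Hz Hz0) as Hn.
  eexists; split.
  - apply (is_Cderive_ext_loc (fun w => f w / w - RtoC 1)%C fz_dev z _ (Cmod z)).
    + apply Cmod_gt_0, Hz0.
    + intros w Hw; symmetry; apply fz_dev_eq, (nonzero_near z w Hw).
    + Cderive; exact Hz0.
  - rewrite fz_dev_eq by exact Hz0; unfold starlike_ratio; field; auto.
Qed.

Lemma Lf_dev_derive (z : C) : in_disk z -> z <> RtoC 0 ->
  exists l, is_Cderive Lf_dev z l /\
    (z * l)%C = ((RtoC 1 - starlike_ratio z) - Lf_dev z * (RtoC 1 + starlike_ratio z))%C.
Proof.
  intros Hz Hz0; pose proof (f_derive z Hz) as H1; pose proof (f_nonzero z Hz Hz0) as Hn.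
  pose proof (f_int_derive z Hz) as H2.
  eexists; split.
  - apply (is_Cderive_ext_loc (fun w => RtoC 2 * f_int w / (w * f w) - RtoC 1)%C Lf_dev z _ (Cmod z)).
    + apply Cmod_gt_0, Hz0.
    + intros w Hw; symmetry; apply Lf_dev_eq, (nonzero_near z w Hw).
    + Cderive; apply Cmult_neq_0; assumption.
  - rewrite Lf_dev_eq by exact Hz0; unfold starlike_ratio; field; auto.
Qed.

Lemma fz_dev_punctured : punctured_analytic fz_dev.
Proof.
  intros z Hz; destruct (Ceq_dec z (RtoC 0)) as [->|Hz0].
  - split; [|intros N; contradiction].
    apply Ccontinuous_eps; intros eps He.
    destruct (f_asymptotic (eps / 2)) as [d [Hd K]]; [lra|].
    exists d; split; [lra|]; intros w; rewrite fz_dev_0.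
    replace (w - RtoC 0)%C with w by ring; replace (fz_dev w - RtoC 0)%C with (fz_dev w) by ring.
    intros Hw; destruct (Ceq_dec w (RtoC 0)) as [->|Hw0]; [rewrite fz_dev_0, Cmod_0; exact He|].
    rewrite fz_dev_eq by exact Hw0.
    replace (f w / w - RtoC 1)%C with ((f w - w) / w)%C by (field; exact Hw0).
    rewrite Cmod_div by exact Hw0. apply Cmod_gt_0 in Hw0.
    apply Rle_lt_trans with (eps / 2); [|lra].
    apply Rmult_le_reg_r with (Cmod w); [exact Hw0|].
    unfold Rdiv at 1; rewrite Rmult_assoc, Rinv_l, Rmult_1_r by lra. apply K, Hw.
  - destruct (fz_dev_derive z Hz Hz0) as [l [Hl _]]; split.
    + eapply is_Cderive_continuous, Hl.
    + intros _; exists l; exact Hl.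
Qed.

Lemma Lf_dev_punctured : punctured_analytic Lf_dev.
Proof.
  intros z Hz; destruct (Ceq_dec z (RtoC 0)) as [->|Hz0].
  - split; [|intros N; contradiction].
    apply Ccontinuous_eps; intros eps He.
    (* The bound 1/2 gives |f(w)| >= |w| / 2. The numerator below is at most 3 e |w|^2, so the
       quotient is at most 6 e, which is less than [eps]. *)
    set (e := Rmin (/ 2) (eps / 8)).
    assert (E0 : 0 < e) by (apply Rmin_glb_lt; lra).
    assert (E1 : e <= / 2) by apply Rmin_l.
    assert (E2 : e <= eps / 8) by apply Rmin_r.
    destruct (f_int_asymptotic e E0) as [d [Hd K]].
    exists d; split; [lra|]; intros w; rewrite Lf_dev_0.
    replace (w - RtoC 0)%C with w by ring; replace (Lf_dev w - RtoC 0)%C with (Lf_dev w) by ring.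
    intros Hw; destruct (Ceq_dec w (RtoC 0)) as [->|Hw0]; [rewrite Lf_dev_0, Cmod_0; exact He|].
    destruct (K w Hw) as [K1 K2].
    assert (Dw : in_disk w) by (unfold in_disk; lra).
    pose proof (f_nonzero w Dw Hw0) as Hn.
    rewrite Lf_dev_eq by exact Hw0.
    replace (RtoC 2 * f_int w / (w * f w) - RtoC 1)%C
      with (((RtoC 2 * f_int w - w * w) - w * (f w - w)) / (w * f w))%C by (field; auto).
    rewrite Cmod_div, (Cmod_mult w (f w)) by (apply Cmult_neq_0; assumption).
    apply Cmod_gt_0 in Hw0; apply Cmod_gt_0 in Hn.
    assert (N : Cmod ((RtoC 2 * f_int w - w * w) - w * (f w - w)) <= 3 * e * (Cmod w * Cmod w)).
    { eapply Rle_trans; [apply Cmod_triangle|].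
      rewrite Cmod_opp, (Cmod_mult w (f w - w)). nra. }
    assert (Fl : Cmod w / 2 <= Cmod (f w)).
    { pose proof (Cmod_minus_ge w (f w)) as T; rewrite Cmod_minus_rev in T; nra. }
    apply Rmult_lt_reg_r with (Cmod w * Cmod (f w)); [nra|].
    unfold Rdiv; rewrite Rmult_assoc, Rinv_l, Rmult_1_r by nra.
    apply Rle_lt_trans with (1 := N).
    assert (W : 0 < Cmod w * Cmod w) by (apply Rmult_lt_0_compat; lra).
    apply Rlt_le_trans with (eps * (Cmod w * (Cmod w / 2))).
    { replace (eps * (Cmod w * (Cmod w / 2))) with (eps / 2 * (Cmod w * Cmod w)) by field.
      apply Rmult_lt_compat_r; lra. }
    apply Rmult_le_compat_l; [lra|]. apply Rmult_le_compat_l; lra.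
  - destruct (Lf_dev_derive z Hz Hz0) as [l [Hl _]]; split.
    + eapply is_Cderive_continuous, Hl.
    + intros _; exists l; exact Hl.
Qed.

(** * Bounds for the two deviations *)

Lemma Cderive_unique (g : C -> C) (z a b : C) :
  is_Cderive g z a -> is_Cderive g z b -> a = b.
Proof.
  intros Ha Hb; rewrite <- (is_C_derive_unique g z a Ha).
  apply is_C_derive_unique, Hb.
Qed.

(** Jack's inequality becomes |v|^2 <= (1 + |v|) M |v|; dividing by |v| and solving gives the
    constant. *)
Lemma fz_dev_bound (z : C) : in_disk z -> Cmod (fz_dev z) <= M / (1 - M).
Proof.
  pose proof M_lt.
  apply jack_bound; [exact fz_dev_punctured|exact fz_dev_0|left; apply Rdiv_lt_0_compat; lra|].
  clear z; intros z l Hz Hz0 Hl HJ.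
  destruct (fz_dev_derive z Hz Hz0) as [l' [Hl' E]].
  rewrite <- (Cderive_unique _ _ _ _ Hl Hl') in E; rewrite E in HJ.
  pose proof (Rle_trans _ _ _ HJ (Re_mult_conj_le _ _)) as K.
  rewrite Cmod_mult in K.
  pose proof (starlike_ratio_bound z Hz Hz0) as Q; pose proof (Cmod_ge_0 (starlike_ratio z - RtoC 1)).
  pose proof (Cmod_triangle (RtoC 1) (fz_dev z)) as T; rewrite Cmod_1 in T.
  pose proof (Cmod_ge_0 (RtoC 1 + fz_dev z)). pose proof (Cmod_ge_0 (fz_dev z)) as V.
  apply Rmult_le_reg_r with (1 - M); [lra|].
  unfold Rdiv; rewrite Rmult_assoc, Rinv_l, Rmult_1_r by lra.
  destruct (Req_dec (Cmod (fz_dev z)) 0) as [E0|N0]; [rewrite E0; lra|].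
  assert (Cmod (fz_dev z) <= (1 + Cmod (fz_dev z)) * M); [|lra].
  apply Rmult_le_reg_r with (Cmod (fz_dev z)); [lra|].
  apply Rle_trans with (Cmod (fz_dev z) ^ 2); [lra|].
  eapply Rle_trans; [exact K|]. apply Rmult_le_compat_r; [lra|].
  apply Rmult_le_compat; lra.
Qed.

(** In Jack's inequality the term -u (1 + q) contributes -Re(1 + q) |u|^2, and Re(1 + q) >= 2 - M.
    Moved to the left it adds to |u|^2, so (3 - M) |u|^2 <= M |u|. Keeping this sign, instead of
    using the triangle inequality, is what produces the 3. *)
Lemma Lf_dev_bound (z : C) : in_disk z -> Cmod (Lf_dev z) <= M / (3 - M).
Proof.
  pose proof M_lt.
  apply jack_bound; [exact Lf_dev_punctured|exact Lf_dev_0|left; apply Rdiv_lt_0_compat; lra|].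
  clear z; intros z l Hz Hz0 Hl HJ.
  destruct (Lf_dev_derive z Hz Hz0) as [l' [Hl' E]].
  rewrite <- (Cderive_unique _ _ _ _ Hl Hl') in E; rewrite E in HJ.
  pose proof (starlike_ratio_bound z Hz Hz0) as Q.
  pose proof (Re_mult_conj_le (RtoC 1 - starlike_ratio z) (Lf_dev z)) as K.
  rewrite (Cmod_minus_rev (RtoC 1)) in K.
  assert (ER : Re ((RtoC 1 - starlike_ratio z - Lf_dev z * (RtoC 1 + starlike_ratio z)) * Cconj (Lf_dev z))
    = Re ((RtoC 1 - starlike_ratio z) * Cconj (Lf_dev z)) - (2 + Re (starlike_ratio z - RtoC 1)) * Cmod (Lf_dev z) ^ 2).
  { rewrite Cmod2_alt; destruct (Lf_dev z), (starlike_ratio z); simpl; ring. }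
  rewrite ER in HJ.
  destruct (Cmod_Re_Im (starlike_ratio z - RtoC 1)%C) as [R1 _].
  pose proof (Rle_abs (- Re (starlike_ratio z - RtoC 1))) as R2; rewrite Rabs_Ropp in R2.
  pose proof (Cmod_ge_0 (Lf_dev z)) as U.
  apply Rmult_le_reg_r with (3 - M); [lra|].
  unfold Rdiv; rewrite Rmult_assoc, Rinv_l, Rmult_1_r by lra.
  destruct (Req_dec (Cmod (Lf_dev z)) 0) as [E0|N0]; [rewrite E0; lra|].
  apply Rmult_le_reg_r with (Cmod (Lf_dev z)); [lra|].
  assert (Cmod (starlike_ratio z - RtoC 1) * Cmod (Lf_dev z) <= M * Cmod (Lf_dev z)) by (apply Rmult_le_compat_r; lra).
  assert (0 <= Cmod (Lf_dev z) ^ 2) by (apply pow_le; lra).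
  nra.
Qed.

(** The derivative of L(f) in a form that also makes sense at 0, where both deviations vanish. Its
    continuity on the whole disk follows from that of the two factors. *)
Definition dLibera (z : C) : C := ((RtoC 1 + fz_dev z) * (RtoC 1 - Lf_dev z))%C.

Lemma dLibera_eq (z : C) : in_disk z -> z <> RtoC 0 ->
  dLibera z = (RtoC 2 * f z / z - RtoC 2 * f_int z / (z * z))%C.
Proof.
  intros Hz Hz0; pose proof (f_nonzero z Hz Hz0) as Hn.
  unfold dLibera; rewrite Lf_dev_eq, fz_dev_eq by exact Hz0; field; auto.
Qed.

Lemma Libera_eq (z : C) : in_disk z -> z <> RtoC 0 -> Libera f z = (RtoC 2 * f_int z / z)%C.
Proof.
  intros Hz Hz0; unfold Libera; destruct (Ceq_dec z (RtoC 0)); [contradiction|].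
  rewrite integral_from_0_eq by exact Hz; field; exact Hz0.
Qed.

Lemma Libera_0 : Libera f (RtoC 0) = RtoC 0.
Proof. unfold Libera; destruct (Ceq_dec (RtoC 0) (RtoC 0)); [reflexivity|contradiction]. Qed.

Lemma dLibera_0 : dLibera (RtoC 0) = RtoC 1.
Proof. unfold dLibera; rewrite Lf_dev_0, fz_dev_0; ring. Qed.

Lemma in_disk_near (z w : C) : Cmod (w - z) < 1 - Cmod z -> in_disk w.
Proof.
  intros H; unfold in_disk; replace w with ((w - z) + z)%C by ring.
  eapply Rle_lt_trans; [apply Cmod_triangle|lra].
Qed.

Lemma punctured_disk_radius (z : C) : in_disk z -> z <> RtoC 0 ->
  exists r, 0 < r /\ forall w, Cmod (w - z) < r -> in_disk w /\ w <> RtoC 0.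
Proof.
  intros Hz Hz0; exists (Rmin (Cmod z) (1 - Cmod z)); split.
  - apply Rmin_glb_lt; [apply Cmod_gt_0, Hz0|unfold in_disk in Hz; lra].
  - intros w Hw; split.
    + apply (in_disk_near z); eapply Rlt_le_trans; [exact Hw|apply Rmin_r].
    + apply (nonzero_near z); eapply Rlt_le_trans; [exact Hw|apply Rmin_l].
Qed.

Lemma Libera_derive (z : C) : in_disk z -> is_Cderive (Libera f) z (dLibera z).
Proof.
  intros Hz; destruct (Ceq_dec z (RtoC 0)) as [->|Hz0].
  - rewrite dLibera_0; apply is_Cderive_eps; intros eps He.
    destruct (f_int_asymptotic (eps / 2)) as [d [Hd K]]; [lra|].
    exists d; split; [lra|]; intros w.
    rewrite Libera_0; replace (w - RtoC 0)%C with w by ring; intros Hw.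
    destruct (Ceq_dec w (RtoC 0)) as [->|Hw0].
    { rewrite Libera_0, Cmod_0.
      replace (RtoC 0 - RtoC 0 - RtoC 0 * RtoC 1)%C with (RtoC 0) by ring.
      rewrite Cmod_0; lra. }
    rewrite Libera_eq by (unfold in_disk; auto; lra).
    replace (RtoC 2 * f_int w / w - RtoC 0 - w * RtoC 1)%C
      with ((RtoC 2 * f_int w - w * w) / w)%C by (field; exact Hw0).
    rewrite Cmod_div by exact Hw0. apply Cmod_gt_0 in Hw0.
    destruct (K w Hw) as [_ K2].
    apply Rmult_le_reg_r with (Cmod w); [exact Hw0|].
    unfold Rdiv at 1; rewrite Rmult_assoc, Rinv_l, Rmult_1_r by lra. lra.
  - destruct (punctured_disk_radius z Hz Hz0) as [r [Hr Hw]].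
    apply (is_Cderive_ext_loc (fun w => RtoC 2 * f_int w / w)%C _ z _ r Hr).
    + intros w H; symmetry; apply Libera_eq; apply Hw, H.
    + pose proof (f_int_derive z Hz) as HI.
      eapply is_Cderive_eq; [Cderive; exact Hz0|].
      rewrite dLibera_eq by auto; field; exact Hz0.
Qed.

Lemma dLibera_continuous (z : C) : in_disk z -> Ccontinuous dLibera z.
Proof.
  intros Hz; apply Ccontinuous_mult.
  - apply Ccontinuous_plus; [apply Ccontinuous_const|apply fz_dev_punctured, Hz].
  - apply Ccontinuous_minus; [apply Ccontinuous_const|apply Lf_dev_punctured, Hz].
Qed.

(** The constant is (1 + M / (1 - M)) (1 + M / (3 - M)) - 1, whose factors are 1 / (1 - M) and 3 /
    (3 - M). *)
Lemma dLibera_near_1 (z : C) : in_disk z ->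
  Cmod (dLibera z - RtoC 1) <= 3 / ((1 - M) * (3 - M)) - 1.
Proof.
  intros Hz; pose proof M_lt.
  pose proof (fz_dev_bound z Hz) as V; pose proof (Lf_dev_bound z Hz) as U.
  pose proof (Cmod_ge_0 (fz_dev z)); pose proof (Cmod_ge_0 (Lf_dev z)).
  replace (dLibera z - RtoC 1)%C with (fz_dev z + (- Lf_dev z + - (fz_dev z * Lf_dev z)))%C by (unfold dLibera; ring).
  eapply Rle_trans; [apply Cmod_triangle|].
  eapply Rle_trans; [apply Rplus_le_compat_l, Cmod_triangle|].
  rewrite !Cmod_opp, Cmod_mult.
  replace (3 / ((1 - M) * (3 - M)) - 1)
    with (M / (1 - M) + (M / (3 - M) + M / (1 - M) * (M / (3 - M)))) by (field; lra).
  repeat apply Rplus_le_compat; auto. apply Rmult_le_compat; auto.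
Qed.

(** Clearing denominators, 3 < 2 (1 - M)(3 - M) is 2 M^2 - 8 M + 3 > 0. *)
Lemma radius_lt_1 : 3 / ((1 - M) * (3 - M)) - 1 < 1.
Proof.
  pose proof M_lt.
  assert (0 < (1 - M) * (3 - M)) by (apply Rmult_lt_0_compat; lra).
  enough (3 / ((1 - M) * (3 - M)) < 2) by lra.
  apply Rmult_lt_reg_r with ((1 - M) * (3 - M)); auto.
  unfold Rdiv; rewrite Rmult_assoc, Rinv_l, Rmult_1_r by lra.
  nra.
Qed.

Lemma dLibera_nonzero (z : C) : in_disk z -> dLibera z <> RtoC 0.
Proof.
  intros Hz E; pose proof (dLibera_near_1 z Hz) as K; pose proof radius_lt_1.
  rewrite E in K; replace (RtoC 0 - RtoC 1)%C with (- RtoC 1)%C in K by ring.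
  rewrite Cmod_opp, Cmod_1 in K; lra.
Qed.

(** The equation is (z F)' = 2 f differentiated once more: z F'' + 2 F' = 2 f'. *)
Lemma dLibera_derive (z : C) : in_disk z -> z <> RtoC 0 ->
  exists l, is_Cderive (C_derive (Libera f)) z l /\
    (z * l)%C = (RtoC 2 * C_derive f z - RtoC 2 * dLibera z)%C.
Proof.
  intros Hz Hz0; destruct (punctured_disk_radius z Hz Hz0) as [r [Hr Hw]].
  pose proof (f_derive z Hz) as H1; pose proof (f_int_derive z Hz) as H2.
  eexists; split.
  - apply (is_Cderive_ext_loc (fun w => RtoC 2 * f w / w - RtoC 2 * f_int w / (w * w))%C _ z _ r Hr).
    + intros w H; destruct (Hw w H) as [Dw Nw].
      rewrite (is_C_derive_unique _ _ _ (Libera_derive w Dw)); symmetry; apply dLibera_eq; auto.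
    + Cderive; [exact Hz0|apply Cmult_neq_0; exact Hz0].
  - rewrite dLibera_eq by auto; field; exact Hz0.
Qed.

Lemma Libera_convex_condition (z : C) : in_disk z -> z <> RtoC 0 ->
  0 < Re (RtoC 1 + z * C_derive (C_derive (Libera f)) z / C_derive (Libera f) z)%C.
Proof.
  intros Hz Hz0; destruct (dLibera_derive z Hz Hz0) as [l [Hl El]].
  rewrite (is_C_derive_unique _ _ _ Hl), (is_C_derive_unique _ _ _ (Libera_derive z Hz)), El.
  pose proof (f_nonzero z Hz Hz0) as Hn; pose proof (dLibera_nonzero z Hz) as Hd.
  assert (Hu : (RtoC 1 - Lf_dev z)%C <> RtoC 0).
  { intros E; apply Hd; unfold dLibera; rewrite E; ring. }
  assert (Hv : (RtoC 1 + fz_dev z)%C <> RtoC 0).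
  { intros E; apply Hd; unfold dLibera; rewrite E; ring. }
  (* Since f' = q (1 + v) and F' = (1 + v)(1 - u), the factor 1 + v cancels. *)
  replace (RtoC 1 + (RtoC 2 * C_derive f z - RtoC 2 * dLibera z) / dLibera z)%C
    with ((RtoC 2 * starlike_ratio z - (RtoC 1 - Lf_dev z)) / (RtoC 1 - Lf_dev z))%C.
  - apply Re_quotient_pos; [exact Hu|].
    pose proof (Lf_dev_bound z Hz) as U; pose proof (starlike_ratio_bound z Hz Hz0) as Q; pose proof M_lt.
    replace (RtoC 1 - Lf_dev z - starlike_ratio z)%C with (- (Lf_dev z + (starlike_ratio z - RtoC 1)))%C by ring.
    rewrite Cmod_opp.
    pose proof (Cmod_triangle (Lf_dev z) (starlike_ratio z - RtoC 1)) as T.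
    pose proof (Cmod_minus_ge (RtoC 1) (starlike_ratio z)) as T2; rewrite Cmod_1, Cmod_minus_rev in T2.
    (* Cleared of the denominator this is M <= (1 - 2 M)(3 - M), the same quadratic as in
       [radius_lt_1]. *)
    assert (M / (3 - M) <= 1 - 2 * M).
    { apply Rmult_le_reg_r with (3 - M); [lra|].
      unfold Rdiv; rewrite Rmult_assoc, Rinv_l by lra. nra. }
    lra.
  - assert (Eq : C_derive f z = (starlike_ratio z * (RtoC 1 + fz_dev z))%C).
    { rewrite fz_dev_eq by exact Hz0; unfold starlike_ratio; field; auto. }
    rewrite Eq; unfold dLibera; field; auto.
Qed.

Lemma Libera_class_K_of_primitive : class_K (Libera f).
Proof.
  split; [|split].
  - split; [|split].
    + intros z Hz; exists (dLibera z); apply Libera_derive, Hz.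
    + exact Libera_0.
    + rewrite (is_C_derive_unique _ _ _ (Libera_derive _ in_disk_0)); exact dLibera_0.
  - exact (univalent_of_derivative_near_1 _ dLibera _ radius_lt_1 Libera_derive
             dLibera_continuous dLibera_near_1).
  - intros z Hz; split.
    + rewrite (is_C_derive_unique _ _ _ (Libera_derive z Hz)); apply dLibera_nonzero, Hz.
    (* At 0 the factor z makes the quotient vanish whatever value [C_derive] takes for the second
       derivative, so the expression is 1. *)
    + destruct (Ceq_dec z (RtoC 0)) as [->|Hz0]; [|apply Libera_convex_condition; auto].
      replace (RtoC 1 + RtoC 0 * C_derive (C_derive (Libera f)) (RtoC 0)
               / C_derive (Libera f) (RtoC 0))%C with (RtoC 1) by (unfold Cdiv; ring).
      rewrite re_RtoC; lra.
Qed.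

End LiberaTransform.

Lemma Libera_class_K (M : R) (f : C -> C) :
  0 < M < sqrt 2 - 1 -> class_S M f -> class_K (Libera f).
Proof.
  intros HM Hf.
  destruct (primitive_in_disk f []) as [G HG].
  - intros z Hz; apply (f_continuous M f Hf z Hz).
  - intros z Hz _; apply Hf, Hz.
  - exact (Libera_class_K_of_primitive M f HM Hf G HG).
Qed.

Theorem theorem4p1 :
  forall M : R, (0 < M < sqrt 2 - 1)%R ->
    (forall f : C -> C, class_S M f -> class_K (Libera f)) /\
    (forall g : C -> C,
       (exists f : C -> C, class_S M f /\ g = Libera f) -> class_K g).
Proof.
  intros M HM; split.
  - intros f; apply Libera_class_K, HM.
  - intros g [f [Hf ->]]; exact (Libera_class_K M f HM Hf).
Qed.
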